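(* Assume $d_I<d_H$. The stopping time $N=N(C)$ of SLINK-SEQ with parameter $C$ satisfies $$\lim_{C\to\infty}\mathbb{E}\Big[\Big|\frac{N}{C^2}-\frac1{d_H^2}\Big|\Big]=0.$$
   Context: Setting: $M\ge2$ mutually independent data sequences; sequence $i$ consists of i.i.d. samples $X^{(i)}_1,X^{(i)}_2,\dots$ from an unknown distribution $p_i$ on $\mathcal X$; $\{1,\dots,M\}$ is partitioned into $K\ge2$ nonempty true clusters $P_1,\dots,P_K$ ($K$ known). $k$ is a measurable positive-definite kernel with $0\le k\le\mathbb{G}$, $\mathcal F$ the unit ball of its RKHS, $d(p,q)=\sup_{f\in\mathcal F}(\mathbb{E}_pf-\mathbb{E}_qf)$ (MMD), $d(i,j)=d(p_i,p_j)$. Estimate: $\hat d(i,j,n)=\Big[\frac1{n^2}\sum_{l,m=1}^n\big(k(X^{(i)}_l,X^{(i)}_m)+k(X^{(j)}_l,X^{(j)}_m)-2k(X^{(i)}_l,X^{(j)}_m)\big)\Big]^{1/2}$. $d_H=\min_{k\neq l}\min_{i\in P_k,j\in P_l}d(i,j)$; $d_I(P_k)=\max\min_{i\in P_{1k},j\in P_{2k}}d(i,j)$ over partitions of $P_k$ into two nonempty disjoint sets (taken as $0$ if $|P_k|=1$); $d_I=\max_kd_I(P_k)$. SLINK with target number $K$ on dissimilarities $\delta$: start from singletons, repeatedly merge two current clusters $A\ne B$ minimizing $\min_{i\in A,j\in B}\delta(i,j)$ (ties arbitrary) until $K$ clusters remain. SLINK-SEQ with parameter $C>0$: at each time $n\ge2$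 (one new sample of every sequence per time step), run SLINK with target $K$ on $\{\hat d(i,j,n)\}$ to get clusters $C_1(n),\dots,C_K(n)$, and compute $\Gamma_n=\min_{k\neq l}\min_{i\in C_k(n),j\in C_l(n)}\hat d(i,j,n)$; the stopping time is $N=\inf\{n\ge2:\Gamma_n\ge C/\sqrt n\}$ and the output is $\{C_1(N),\dots,C_K(N)\}$. *)

(* Defs.v *)
From HB Require Import structures.
From Stdlib Require Import Relations.
From mathcomp Require Import all_boot all_order all_algebra.
From mathcomp Require Import all_classical all_reals all_analysis.
Set Implicit Arguments. Unset Strict Implicit. Unset Printing Implicit Defensive.
Import Order.TTheory GRing.Theory Num.Theory.
Import numFieldNormedType.Exports.
Local Open Scope classical_set_scope.
Local Open Scope ring_scope.

Section Defs.
Variable R : realType.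

Definition pd_kernel (T : Type) (k : T -> T -> R) : Prop :=
  (forall x y, k x y = k y x) /\
  (forall (n : nat) (x : 'I_n -> T) (c : 'I_n -> R),
      0 <= \sum_(a < n) \sum_(b < n) c a * c b * k (x a) (x b)).

(* unit ball of the RKHS of k (Aronszajn / Moore characterisation:
   f is in H(k) with ||f|| <= 1 iff k - f (x) f is positive semidefinite);
   RKHS functions of a measurable kernel are measurable. *)
Definition rkhs_unit_ball d (T : measurableType d) (k : T -> T -> R)
  : set (T -> R) :=
  [set f | measurable_fun setT f /\
     forall (n : nat) (x : 'I_n -> T) (c : 'I_n -> R),
       (\sum_(a < n) c a * f (x a)) ^+ 2 <=
       \sum_(a < n) \sum_(b < n) c a * c b * k (x a) (x b)].

Definition mmd d (T : measurableType d) (k : T -> T -> R)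
  (p q : probability T R) : R :=
  sup [set Rintegral p setT f - Rintegral q setT f | f in rkhs_unit_ball k].

Definition dist_pop d (T : measurableType d) (k : T -> T -> R) (M : nat)
  (p : 'I_M -> probability T R) (i j : 'I_M) : R := mmd k (p i) (p j).

Definition linkage (M : nat) (delta : 'I_M -> 'I_M -> R) (A B : {set 'I_M}) : R :=
  inf [set x | exists i j, i \in A /\ j \in B /\ x = delta i j].

Definition cluster (M K : nat) (lab : 'I_M -> 'I_K) (c : 'I_K) : {set 'I_M} :=
  [set i | lab i == c].

Definition d_H (M K : nat) (delta : 'I_M -> 'I_M -> R) (lab : 'I_M -> 'I_K) : R :=
  inf [set x | exists c c', c != c' /\ x = linkage delta (cluster lab c) (cluster lab c')].

(* d_I(P_k) = max over splits of P_k into two nonempty disjoint sets of the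
   min cross distance; 0 if there is no split (|P_k| = 1) *)
Definition d_I_cluster (M : nat) (delta : 'I_M -> 'I_M -> R) (Pk : {set 'I_M}) : R :=
  \big[Num.max/0]_(A : {set 'I_M} | (A \subset Pk) && (A != finset.set0) && (A != Pk))
     linkage delta A (Pk :\: A).

Definition d_I (M K : nat) (delta : 'I_M -> 'I_M -> R) (lab : 'I_M -> 'I_K) : R :=
  \big[Num.max/0]_(c : 'I_K) d_I_cluster delta (cluster lab c).

Definition slink_init (M : nat) : {set {set 'I_M}} := ((fun i : 'I_M => finset.set1 i) @: finset.setT).

(* one merge step: merge two distinct current clusters of minimal linkage
   (ties broken arbitrarily) *)
Definition slink_step (M : nat) (delta : 'I_M -> 'I_M -> R)
  (Q Q' : {set {set 'I_M}}) : Prop :=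
  exists A B, A \in Q /\ B \in Q /\ A != B /\
    (forall A' B', A' \in Q -> B' \in Q -> A' != B' ->
        linkage delta A B <= linkage delta A' B') /\
    Q' = (Q :\ A :\ B) :|: finset.set1 (A :|: B).

Definition slink_output (M K : nat) (delta : 'I_M -> 'I_M -> R)
  (Q : {set {set 'I_M}}) : Prop :=
  clos_refl_trans _ (@slink_step M delta) (slink_init M) Q /\ #|Q| = K.

Definition slink_gamma (M : nat) (delta : 'I_M -> 'I_M -> R)
  (Q : {set {set 'I_M}}) : R :=
  inf [set x | exists A B, A \in Q /\ B \in Q /\ A != B /\ x = linkage delta A B].

Definition hat_d (T : Type) (k : T -> T -> R) (M : nat)
  (xs : 'I_M -> nat -> T) (n : nat) (i j : 'I_M) : R :=
  Num.sqrt ((n%:R ^+ 2)^-1 *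
    \sum_(l < n) \sum_(m < n)
      (k (xs i l) (xs i m) + k (xs j l) (xs j m) - 2 * k (xs i l) (xs j m))).

(* stopping time N = inf {n >= 2 : Gamma_n >= C / sqrt n}, +oo if empty *)
Definition stop_time (Gam : nat -> R) (C : R) : \bar R :=
  ereal_inf [set (n%:R)%:E | n in
    [set n : nat | (2 <= n)%N /\ C / Num.sqrt (n%:R) <= Gam n]].

Definition mutually_independent d (Om : measurableType d) (P : probability Om R)
  (I : eqType) d' (T : measurableType d') (Y : I -> Om -> T) : Prop :=
  forall (s : seq I) (A : I -> set T), uniq s -> (forall i, measurable (A i)) ->
    P (\big[setI/setT]_(i <- s) (Y i @^-1` A i)) =
    \big[*%E/1%E]_(i <- s) P (Y i @^-1` A i).

End Defs.

(* Main.v *)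
Require Import Defs.
From HB Require Import structures.
From Stdlib Require Import Relations.
From mathcomp Require Import all_boot all_order all_algebra.
From mathcomp Require Import all_classical all_reals all_analysis.
From mathcomp Require Import measurable_realfun zify ring lra.
Import Order.TTheory GRing.Theory Num.Theory.
Import numFieldNormedType.Exports.
Local Open Scope classical_set_scope.
Local Open Scope ring_scope.

(** Single linkage maximizes, among all K-clusterings, the smallest distance
    between two clusters; when d_I < d_H this maximum is d_H for the population
    distances. It is 1-Lipschitz in the dissimilarities, so
    |Gamma_n - d_H| <= max_(i, j) |hat_d(i, j, n) - d(i, j)|.
    Both distances are suprema over the RKHS unit ball, hence
    |hat_d(i, j, n) - d(i, j)| <= sqrt W_i + sqrt W_j, where W_i is the squared RKHS
    distance between the empirical and the population mean embeddings of
    sequence i. W_i is a degenerate V-statistic: in the expansion of E[W_i^2] only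
    3 n^2 of the n^4 terms survive, so E[W_i^2] = O(1/n^2) is summable.

    If Z_n := 16 eps^-4 sum_i W_i^2 < 1 then |Gamma_n - d_H| <= eps. So a stop
    before C^2/(d_H + eps)^2, or a failure to stop at some n >= C^2/(d_H - eps)^2,
    forces Z_n >= 1 at that n, and |N/C^2 - 1/d_H^2| is bounded pointwise by
    (d_H - eps)^-2 - (d_H + eps)^-2 + 3/C^2 + (1 + d_H^-2) sum_(n >= n0) Z_n with
    n0 of order C^2. Integrate, let C tend to infinity, then eps to 0. *)

(** * Linkage, [d_H] and [d_I] as minima and maxima over finite sets *)

Section Linkage.
Context {R : realType}.

Lemma inf_min (E : set R) (x : R) : E x -> lbound E x -> inf E = x.
Proof.
move=> Ex lbx; apply/eqP; rewrite eq_le; apply/andP; split.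
  by apply: ge_inf => //; exists x.
by apply: lb_le_inf => //; exists x.
Qed.

Context {M : nat} (delta : 'I_M -> 'I_M -> R).

(** A real infimum bounds the members of a set only if the set is bounded below; the minimum of
    [delta] over all pairs supplies such a bound. *)
Lemma linkage_le (A B : {set 'I_M}) i j :
  i \in A -> j \in B -> linkage delta A B <= delta i j.
Proof.
move=> iA jB; apply: ge_inf; last by exists i, j.
case: (@arg_minP _ _ _ (i, i) xpredT (fun q => delta q.1 q.2) isT).
move=> q _ qmin; exists (delta q.1 q.2) => _ [i' [j' [_ [_ ->]]]].
exact: (qmin (i', j')).
Qed.

Lemma linkage_attained (A B : {set 'I_M}) :
  A != finset.set0 -> B != finset.set0 ->
  exists i j, [/\ i \in A, j \in B & linkage delta A B = delta i j].
Proof.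
move=> /set0Pn[i iA] /set0Pn[j jB].
have PAB : ((i, j).1 \in A) && ((i, j).2 \in B) by rewrite /= iA.
case: (@arg_minP _ _ _ (i, j) (fun q => (q.1 \in A) && (q.2 \in B))
  (fun q => delta q.1 q.2) PAB) => -[i' j'] /= /andP[i'A j'B] qmin.
exists i', j'; split => //; apply: inf_min; first by exists i', j'.
by move=> _ [a [b [aA [bB ->]]]]; apply: (qmin (a, b)); rewrite aA.
Qed.

Context {K : nat} (lab : 'I_M -> 'I_K).
Hypothesis lab_surj : forall c, exists i, lab i = c.
Hypothesis K2 : (2 <= K)%N.

Let cluster_neq0 c : Defs.cluster lab c != finset.set0.
Proof. by apply/set0Pn; have [i <-] := lab_surj c; exists i; rewrite inE. Qed.

(** Surjectivity of [lab] and [2 <= K] keep every infimum inside [d_H] over a nonempty set;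
    finiteness then makes it a minimum. *)
Lemma d_H_attained : exists i j, [/\ lab i != lab j, d_H delta lab = delta i j &
  forall i' j', lab i' != lab j' -> d_H delta lab <= delta i' j'].
Proof.
have [i li] := lab_surj (Ordinal (ltnW K2)).
have [j lj] := lab_surj (Ordinal K2).
have lij : lab (i, j).1 != lab (i, j).2 by rewrite /= li lj.
case: (@arg_minP _ _ _ (i, j) (fun q => lab q.1 != lab q.2)
  (fun q => delta q.1 q.2) lij) => -[a b] /= lab_ab qmin.
suff dHE : d_H delta lab = delta a b.
  exists a, b; split => // i' j' lij'.
  by rewrite dHE; apply: (qmin (i', j')).
apply: inf_min.
  exists (lab a), (lab b); split => //; apply/esym/inf_min.
    by exists a, b; rewrite !inE.
  move=> _ [x [y [+ [+ ->]]]]; rewrite !inE => /eqP xa /eqP yb.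
  by apply: (qmin (x, y)) => /=; rewrite xa yb.
move=> _ [c [c' [cc' ->]]].
have [x [y [+ + ->]]] := linkage_attained _ _ (cluster_neq0 c) (cluster_neq0 c').
rewrite !inE => /eqP xc /eqP yc.
by apply: (qmin (x, y)) => /=; rewrite xc yc.
Qed.

(** Since [A] cuts cluster [c], its trace on that cluster is one of the splits over which [d_I]
    maximizes. *)
Lemma d_I_split c (A : {set 'I_M}) :
  (exists2 i, lab i = c & i \in A) -> (exists2 i, lab i = c & i \notin A) ->
  exists i j, [/\ i \in A, j \notin A & delta i j <= d_I delta lab].
Proof.
move=> [i ic iA] [j jc jA].
pose P := Defs.cluster lab c.
have AP0 : A :&: P != finset.set0 by apply/set0Pn; exists i; rewrite !inE iA ic eqxx.
have PA0 : P :\: (A :&: P) != finset.set0.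
  by apply/set0Pn; exists j; rewrite !inE (negbTE jA) jc eqxx.
have [x [y [+ + xyE]]] := linkage_attained _ _ AP0 PA0.
rewrite !inE => /andP[xA xP] /andP[yA yP]; exists x, y; split => //.
  by move: yA; rewrite yP andbT.
rewrite -xyE; apply: (@le_trans _ _ (d_I_cluster delta P)); last first.
  exact: (le_bigmax 0 (fun c => d_I_cluster delta (Defs.cluster lab c)) c).
apply: (@le_bigmax_cond _ _ _ 0 (A :&: P) _ (fun A => linkage delta A (P :\: A))).
rewrite subsetIr AP0 /=; apply: contra PA0 => /eqP ->.
by rewrite finset.setDv.
Qed.

End Linkage.

(** * Clusterings produced by SLINK and their spacing *)

Section Slink.
Context {R : realType} {M K : nat} (delta : 'I_M -> 'I_M -> R).

Definition is_clustering (Q : {set {set 'I_M}}) : Prop :=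
  [/\ forall A, A \in Q -> A != finset.set0,
      forall i, exists2 A, A \in Q & i \in A &
      forall A B i, A \in Q -> B \in Q -> i \in A -> i \in B -> A = B].

Lemma slink_init_clustering : is_clustering (slink_init M).
Proof.
split=> [A /imsetP[i _ ->]|i|A B i /imsetP[a _ ->] /imsetP[b _ ->]].
- by apply/set0Pn; exists i; rewrite inE.
- by exists [set i]%SET; rewrite ?inE//; apply/imsetP; exists i.
- by rewrite !inE => /eqP <- /eqP <-.
Qed.

Lemma mem_merge (Q : {set {set 'I_M}}) (A B X : {set 'I_M}) :
  (X \in (Q :\ A :\ B) :|: finset.set1 (A :|: B)) =
  ((X != B) && (X != A) && (X \in Q)) || (X == A :|: B).
Proof. by rewrite !inE andbA. Qed.

Lemma slink_step_clustering Q Q' :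
  slink_step delta Q Q' -> is_clustering Q -> is_clustering Q'.
Proof.
move=> [A [B [AQ [BQ [AB [_ ->]]]]]] [Q0 Qc Qd]; split.
- move=> X; rewrite mem_merge => /orP[/andP[_ /Q0]//|/eqP ->].
  by have /set0Pn[i iA] := Q0 _ AQ; apply/set0Pn; exists i; rewrite inE iA.
- move=> i; have [X XQ iX] := Qc i.
  have [XA|XA] := eqVneq X A.
    by exists (A :|: B); rewrite ?mem_merge ?eqxx ?orbT// inE -XA iX.
  have [XB|XB] := eqVneq X B.
    by exists (A :|: B); rewrite ?mem_merge ?eqxx ?orbT// inE -XB iX orbT.
  by exists X; rewrite // mem_merge XA XB XQ.
(* By disjointness of the old blocks, an unmerged block shares no point with the merged one. *)
have mix X i : X != B -> X != A -> X \in Q -> i \in X -> i \in A :|: B -> False.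
  move=> XB XA XQ iX; rewrite inE => /orP[iA|iB].
    by move/eqP: XA; apply; apply: Qd XQ AQ iX iA.
  by move/eqP: XB; apply; apply: Qd XQ BQ iX iB.
move=> X Y i; rewrite !mem_merge.
move=> /orP[/andP[/andP[XB XA] XQ]|/eqP ->] /orP[/andP[/andP[YB YA] YQ]|/eqP ->] //.
- exact: Qd.
- by move=> iX iAB; case: (mix X i).
- by move=> iAB iY; case: (mix Y i).
Qed.

Definition separated (s : R) (Q : {set {set 'I_M}}) : Prop :=
  forall A B i j, A \in Q -> B \in Q -> A != B -> i \in A -> j \in B ->
    s <= delta i j.

(** A cross pair of the merged block was already a cross pair of one of the two blocks it unites. *)
Lemma slink_step_separated s Q Q' :
  slink_step delta Q Q' -> separated s Q -> separated s Q'.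
Proof.
move=> [A [B [AQ [BQ [AB [_ ->]]]]]] sQ X Y i j; rewrite !mem_merge.
have oth Z : Z != B -> Z != A -> A != Z /\ B != Z by rewrite !(eq_sym Z).
move=> /orP[/andP[/andP[XB XA] XQ]|/eqP ->] /orP[/andP[/andP[YB YA] YQ]|/eqP ->] //.
- exact: sQ.
- move=> _ iX; rewrite inE => /orP[jA|jB]; first exact: (sQ X A).
  exact: (sQ X B).
- have [AY BY] := oth _ YB YA.
  move=> _; rewrite inE => /orP[iA|iB] jY; first exact: (sQ A Y).
  exact: (sQ B Y).
- by rewrite eqxx.
Qed.

Definition refines (lab : 'I_M -> 'I_K) (Q : {set {set 'I_M}}) : Prop :=
  forall A i j, A \in Q -> i \in A -> j \in A -> lab i = lab j.

(* As long as Q refines the labels, a merge across labels is a closest pair of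
   clusters at distance at least s, so from then on Q is s-separated. *)
Lemma slink_invariant (lab : 'I_M -> 'I_K) s Q :
  (forall i j, lab i != lab j -> s <= delta i j) ->
  clos_refl_trans _ (@slink_step R M delta) (slink_init M) Q ->
  is_clustering Q /\ (refines lab Q \/ separated s Q).
Proof.
move=> slab rt; elim: (clos_rt_rtn1 _ _ _ _ rt) => [|Q1 Q2 st _ [cQ1 IH]].
  split; first exact: slink_init_clustering.
  by left=> A i j /imsetP[a _ ->]; rewrite !inE => /eqP -> /eqP ->.
split; first exact: slink_step_clustering st cQ1.
case: IH => [rQ|sQ]; last by right; exact: slink_step_separated st sQ.
have st' := st; case: st' => A [B [AQ [BQ [AB [minAB Q2E]]]]].
case: cQ1 => Q0 _ _.
have /set0Pn[a aA] := Q0 _ AQ; have /set0Pn[b bB] := Q0 _ BQ.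
have [lab_ab|lab_ab] := eqVneq (lab a) (lab b).
  left=> X i j; rewrite Q2E mem_merge => /orP[/andP[_ XQ]|/eqP ->]; first exact: rQ.
  rewrite !inE => ij.
  have lA x : x \in A -> lab x = lab a by move=> xA; exact: rQ AQ xA aA.
  have lB x : x \in B -> lab x = lab a by move=> xB; rewrite lab_ab; exact: rQ BQ xB bB.
  have lAB x : (x \in A) || (x \in B) -> lab x = lab a by case/orP=> [/lA|/lB].
  by move: ij => /lAB -> /lAB ->.
right; apply: slink_step_separated st _ => X Y i j XQ YQ XY iX jY.
apply: le_trans (linkage_le _ _ _ _ _ iX jY).
apply: le_trans (minAB _ _ XQ YQ XY).
have [x [y [xA yB ->]]] := linkage_attained delta _ _ (Q0 _ AQ) (Q0 _ BQ).
by apply: slab; rewrite (rQ _ _ _ AQ xA aA) (rQ _ _ _ BQ yB bB).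
Qed.

Hypothesis K2 : (2 <= K)%N.

(** [2 <= K] provides two distinct blocks, so the infimum is not that of the empty set. *)
Lemma slink_gamma_ge Q s : is_clustering Q -> #|Q| = K -> separated s Q ->
  s <= slink_gamma delta Q.
Proof.
move=> [Q0 _ _] QK sQ.
have /card_gt1P[A [B [AQ BQ AB]]] : (1 < #|Q|)%N by rewrite QK.
apply: lb_le_inf; first by exists (linkage delta A B), A, B.
move=> _ [X [Y [XQ [YQ [XY ->]]]]].
have [x [y [xX yY ->]]] := linkage_attained delta _ _ (Q0 _ XQ) (Q0 _ YQ).
exact: (sQ X Y).
Qed.

Lemma slink_gamma_le Q A B i j : is_clustering Q -> A \in Q -> B \in Q -> A != B ->
  i \in A -> j \in B -> slink_gamma delta Q <= delta i j.
Proof.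
move=> [Q0 _ _] AQ BQ AB iA jB; apply: le_trans (linkage_le _ _ _ _ _ iA jB).
apply: ge_inf; last by exists A, B.
case: (@arg_minP _ _ _ (i, i) xpredT (fun q => delta q.1 q.2) isT).
move=> q _ qmin; exists (delta q.1 q.2) => _ [X [Y [XQ [YQ [XY ->]]]]].
have [x [y [_ _ ->]]] := linkage_attained delta _ _ (Q0 _ XQ) (Q0 _ YQ).
exact: (qmin (x, y)).
Qed.

Variable lab : 'I_M -> 'I_K.
Hypothesis lab_surj : forall c, exists i, lab i = c.

(** Counting: every label occurs in some block and each block carries a single label, so with [K]
    blocks there is exactly one block per label, and distinct blocks carry distinct labels. *)
Lemma refines_separated Q s : (forall i j, lab i != lab j -> s <= delta i j) ->
  is_clustering Q -> #|Q| = K -> refines lab Q -> separated s Q.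
Proof.
move=> slab [Q0 Qc Qd] QK rQ A B i j AQ BQ AB iA jB; apply: slab.
apply: contra AB => /eqP lij.
have [f fP] : {f : 'I_K -> {set 'I_M} &
    forall c, f c \in Q /\ exists2 x, x \in f c & lab x = c}.
  apply: (choice (P := fun c X => X \in Q /\ exists2 x, x \in X & lab x = c)) => c.
  have [x <-] := lab_surj c; have [X XQ xX] := Qc x.
  by exists X; split=> //; exists x.
have f_inj : injective f.
  move=> c c'; have [XQ [x xX lx]] := fP c; have [_ [y yY ly]] := fP c'.
  by move=> XY; rewrite -lx -ly; apply: (rQ _ _ _ XQ xX); rewrite XY.
have fQ : f @: 'I_K = Q.
  apply/eqP; rewrite eqEcard card_imset// card_ord QK leqnn andbT.
  by apply/fintype.subsetP => X /imsetP[c _ ->]; have [] := fP c.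
have fB X x : X \in Q -> x \in X -> X = f (lab x).
  rewrite -{1}fQ => /imsetP[c _ ->] xc; have [cQ [z zc lzc]] := fP c.
  by rewrite (rQ _ _ _ cQ xc zc) lzc.
by rewrite (fB A i)// (fB B j)// lij.
Qed.

(** Either some block cuts a true cluster, which yields a cross pair at distance at most [d_I]; or
    every block is a union of true clusters, and having [K] blocks makes [Q] the true clustering,
    whose closest cross pair realizes [d_H]. *)
Lemma d_H_max_spacing (Q : {set {set 'I_M}}) (d : 'I_M -> 'I_M -> R) :
  is_clustering Q -> #|Q| = K -> d_I d lab < d_H d lab ->
  exists A B i j, [/\ A \in Q, B \in Q, A != B, i \in A & j \in B] /\
    d i j <= d_H d lab.
Proof.
move=> [Q0 Qc Qd] QK dIH.
have [[A [c [AQ iA jA]]]|nsplit] := pselect (exists A c, [/\ A \in Q,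
    exists2 i, lab i = c & i \in A & exists2 i, lab i = c & i \notin A]).
  have [i [j [{}iA {}jA dij]]] := d_I_split d lab c A iA jA.
  have [B BQ jB] := Qc j.
  exists A, B, i, j; split; last exact: ltW (le_lt_trans dij dIH).
  by split=> //; apply: contraNneq jA => ->.
have blk_lab A i j : A \in Q -> lab i = lab j -> i \in A -> j \in A.
  move=> AQ lij iA; apply: contrapT => /negP jA; apply: nsplit.
  by exists A, (lab i); split => //; [exists i|exists j].
have [f fP] : {f : 'I_K -> {set 'I_M} &
    forall c, f c \in Q /\ exists2 x, x \in f c & lab x = c}.
  apply: (choice (P := fun c X => X \in Q /\ exists2 x, x \in X & lab x = c)) => c.
  have [x <-] := lab_surj c; have [X XQ xX] := Qc x.
  by exists X; split=> //; exists x.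
have fE A i : A \in Q -> i \in A -> f (lab i) = A.
  move=> AQ iA; have [ZQ [z zZ lzi]] := fP (lab i).
  by apply: (Qd _ _ z) => //; exact: blk_lab AQ (esym lzi) iA.
have fQ : f @: 'I_K = Q.
  apply/setP => X; apply/imsetP/idP => [[c _ ->]|XQ].
    by have [] := fP c.
  by have /set0Pn[i iX] := Q0 _ XQ; exists (lab i) => //; rewrite (fE X).
have f_inj : {in 'I_K &, injective f}.
  by apply/imset_injP; rewrite fQ QK card_ord.
have [i [j [lij dHE _]]] := d_H_attained d lab lab_surj K2.
have [A AQ iA] := Qc i; have [B BQ jB] := Qc j.
exists A, B, i, j; split; last by rewrite dHE.
split=> //; apply: contra lij => /eqP AB.
by apply/eqP/f_inj => //; rewrite (fE A)// (fE B).
Qed.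

(* SLINK maximizes the spacing among K-clusterings, and d_H is the maximal
   spacing for d; spacings are 1-Lipschitz in the dissimilarity. *)
Lemma slink_gamma_close (d : 'I_M -> 'I_M -> R) e Q :
  (forall i j, `|delta i j - d i j| <= e) -> slink_output K delta Q ->
  d_I d lab < d_H d lab -> `|slink_gamma delta Q - d_H d lab| <= e.
Proof.
move=> de [rQ QK] dIH.
have sd i j : lab i != lab j -> d_H d lab - e <= delta i j.
  move=> lij; have [_ [_ [_ _ /(_ i j lij)]]] := d_H_attained d lab lab_surj K2.
  by have := de i j; rewrite ler_norml => /andP[]; lra.
have [cQ rs] := slink_invariant lab _ Q sd rQ.
have sQ : separated (d_H d lab - e) Q.
  by case: rs => // rQ'; exact: refines_separated.
have := slink_gamma_ge Q _ cQ QK sQ.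
have [A [B [i [j [[AQ BQ AB iA jB] dij]]]]] := d_H_max_spacing Q d cQ QK dIH.
have := slink_gamma_le Q A B i j cQ AQ BQ AB iA jB.
by have := de i j; rewrite !ler_norml => /andP[]; lra.
Qed.

End Slink.

(** * Bilinear forms of positive-definite kernels *)

Section PositiveDefinite.
Context {R : realType} {T : Type}.

Lemma sum_split {m n : nat} (F : 'I_m + 'I_n -> R) :
  \sum_(a < m + n) F (fintype.split a) = \sum_(l < m) F (inl l) + \sum_(r < n) F (inr r).
Proof.
rewrite big_split_ord; congr (_ + _); apply: eq_bigr => i _; congr F.
  exact: (unsplitK (inl i)).
exact: (unsplitK (inr i)).
Qed.

(** For positive-definite [h], the RKHS inner product of [sum_a c_a h(x_a, .)] and
    [sum_b e_b h(y_b, .)]. *)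
Definition kernel_form (h : T -> T -> R) {m n : nat} (c : 'I_m -> R) (x : 'I_m -> T)
  (e : 'I_n -> R) (y : 'I_n -> T) : R :=
  \sum_(a < m) \sum_(b < n) c a * e b * h (x a) (y b).

(** Positive definiteness speaks of one weighted family of points; concatenation makes it applicable
    to two samples at once. *)
Definition glue {A : Type} {m n : nat} (u : 'I_m -> A) (v : 'I_n -> A)
  (a : 'I_(m + n)) : A :=
  match fintype.split a with inl l => u l | inr r => v r end.

Lemma kernel_form_gluel h {m n q : nat} (c : 'I_m -> R) (x : 'I_m -> T)
    (e : 'I_n -> R) (y : 'I_n -> T) (u : 'I_q -> R) (z : 'I_q -> T) :
  kernel_form h (glue c e) (glue x y) u z = kernel_form h c x u z + kernel_form h e y u z.
Proof.
exact: (sum_split (fun s => \sum_(b < q)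
  (match s with inl l => c l | inr r => e r end) * u b *
  h (match s with inl l => x l | inr r => y r end) (z b))).
Qed.

Lemma kernel_form_gluer h {m n q : nat} (c : 'I_m -> R) (x : 'I_m -> T)
    (e : 'I_n -> R) (y : 'I_n -> T) (u : 'I_q -> R) (z : 'I_q -> T) :
  kernel_form h u z (glue c e) (glue x y) = kernel_form h u z c x + kernel_form h u z e y.
Proof.
rewrite /kernel_form -big_split; apply: eq_bigr => a _.
exact: (sum_split (fun s => u a * (match s with inl l => c l | inr r => e r end) *
  h (z a) (match s with inl l => x l | inr r => y r end))).
Qed.

Lemma kernel_formZl h {m n : nat} s (c : 'I_m -> R) (x : 'I_m -> T)
    (e : 'I_n -> R) (y : 'I_n -> T) :
  kernel_form h (fun a => s * c a) x e y = s * kernel_form h c x e y.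
Proof.
rewrite /kernel_form mulr_sumr; apply: eq_bigr => a _.
by rewrite mulr_sumr; apply: eq_bigr => b _; rewrite !mulrA.
Qed.

Lemma kernel_formZr h {m n : nat} s (c : 'I_m -> R) (x : 'I_m -> T)
    (e : 'I_n -> R) (y : 'I_n -> T) :
  kernel_form h c x (fun b => s * e b) y = s * kernel_form h c x e y.
Proof.
rewrite /kernel_form mulr_sumr; apply: eq_bigr => a _.
by rewrite mulr_sumr; apply: eq_bigr => b _; ring.
Qed.

Lemma kernel_form_subtensor (h : T -> T -> R) (f : T -> R) {m n : nat}
    (c : 'I_m -> R) (x : 'I_m -> T) (e : 'I_n -> R) (y : 'I_n -> T) :
  kernel_form (fun u v => h u v - f u * f v) c x e y = kernel_form h c x e y -
  (\sum_(a < m) c a * f (x a)) * (\sum_(b < n) e b * f (y b)).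
Proof.
rewrite /kernel_form mulr_suml -sumrB; apply: eq_bigr => a _.
by rewrite mulr_sumr -sumrB; apply: eq_bigr => b _; ring.
Qed.

Context (h : T -> T -> R) (hpd : pd_kernel h).

Lemma kernel_formC {m n : nat} (c : 'I_m -> R) (x : 'I_m -> T)
    (e : 'I_n -> R) (y : 'I_n -> T) :
  kernel_form h c x e y = kernel_form h e y c x.
Proof.
case: hpd => hC _; rewrite /kernel_form exchange_big; apply: eq_bigr => a _.
by apply: eq_bigr => b _; rewrite hC; ring.
Qed.

(** This is the expanded squared RKHS norm of the sum of two kernel combinations. *)
Lemma pd_form_add_ge0 {m n : nat} (c : 'I_m -> R) (x : 'I_m -> T)
    (e : 'I_n -> R) (y : 'I_n -> T) :
  0 <= kernel_form h c x c x + 2 * kernel_form h c x e y + kernel_form h e y e y.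
Proof.
case: hpd => _ /(_ _ (glue x y) (glue c e)).
rewrite -/(kernel_form h (glue c e) (glue x y) (glue c e) (glue x y)).
rewrite kernel_form_gluel !kernel_form_gluer (kernel_formC e y c x).
by move=> /le_trans; apply; lra.
Qed.

Lemma pd_cauchy_schwarz {m n : nat} (c : 'I_m -> R) (x : 'I_m -> T)
    (e : 'I_n -> R) (y : 'I_n -> T) : 0 < kernel_form h e y e y ->
  kernel_form h c x e y ^+ 2 <= kernel_form h c x c x * kernel_form h e y e y.
Proof.
move=> E0.
set E := kernel_form h e y e y in E0 *; set B := kernel_form h c x e y.
(* These weights turn the squared norm into [E * (E * A - B ^+ 2)], from which [E > 0] cancels. *)
have := pd_form_add_ge0 (fun a => E * c a) x (fun b => - B * e b) y.
rewrite !(kernel_formZl, kernel_formZr) -/E -/B.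
set A := kernel_form h c x c x => H.
rewrite -(ler_pM2l E0); nra.
Qed.

End PositiveDefinite.

(** * The RKHS unit ball and the dual form of [hat_d] *)

Section RkhsBall.
Context {R : realType} {d : measure_display} {T : measurableType d}.
Context (k : T -> T -> R) (kpd : pd_kernel k).
Implicit Types (f : T -> R) (x y : nat -> T).

Definition emp_mean n x f : R := n%:R^-1 * \sum_(l < n) f (x l).

(** [n ^+ 2] times the squared RKHS distance between the two empirical mean embeddings. *)
Definition sample_gap n x y : R :=
  \sum_(l < n) \sum_(m < n) (k (x l) (x m) + k (y l) (y m) - 2 * k (x l) (y m)).

(** The inequality defining the ball is positivity of [k] minus the rank-one kernel of [f]. Every
    positivity result, applied to this difference, becomes a bound on [f]. *)
Lemma rkhs_ball_pd f : rkhs_unit_ball k f -> pd_kernel (fun u v => k u v - f u * f v).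
Proof.
case: kpd => kC _ [_ fk]; split=> [u v|n z c]; first by rewrite kC mulrC.
rewrite -/(kernel_form (fun u v => k u v - f u * f v) c z c z) kernel_form_subtensor subr_ge0 -expr2.
exact: fk.
Qed.

Let sign_form h n x y : kernel_form h (fun=> 1) (fun l : 'I_n => x l) (fun=> -1)
    (fun l : 'I_n => y l) = - \sum_(l < n) \sum_(m < n) h (x l) (y m) :> R.
Proof.
rewrite -sumrN; apply: eq_bigr => l _; rewrite -sumrN.
by apply: eq_bigr => m _; rewrite mul1r mulN1r.
Qed.

Let sign_formV h n x : kernel_form h (fun=> -1) (fun l : 'I_n => x l) (fun=> -1)
    (fun l : 'I_n => x l) = \sum_(l < n) \sum_(m < n) h (x l) (x m) :> R.
Proof. by apply: eq_bigr => l _; apply: eq_bigr => m _; rewrite mulrNN !mul1r. Qed.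

Let sign_form1 h n x : kernel_form h (fun=> 1) (fun l : 'I_n => x l) (fun=> 1)
    (fun l : 'I_n => x l) = \sum_(l < n) \sum_(m < n) h (x l) (x m) :> R.
Proof. by apply: eq_bigr => l _; apply: eq_bigr => m _; rewrite !mul1r. Qed.

Let sample_gapE n x y : sample_gap n x y =
  \sum_(l < n) \sum_(m < n) k (x l) (x m) + \sum_(l < n) \sum_(m < n) k (y l) (y m)
  - 2 * \sum_(l < n) \sum_(m < n) k (x l) (y m).
Proof.
rewrite mulr_sumr -big_split -sumrB; apply: eq_bigr => l _.
by rewrite mulr_sumr -big_split -sumrB.
Qed.

(** Put weights [1] on [x] and [-1] on [y] in the form of [k] minus the rank-one kernel of [f]; the
    rank-one part contributes the square. *)
Lemma sample_gap_ge n x y f : rkhs_unit_ball k f ->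
  (\sum_(l < n) f (x l) - \sum_(l < n) f (y l)) ^+ 2 <= sample_gap n x y.
Proof.
move=> /rkhs_ball_pd kf.
have := pd_form_add_ge0 _ kf (fun=> 1) (fun l : 'I_n => x l) (fun=> -1)
  (fun l : 'I_n => y l).
rewrite !kernel_form_subtensor sign_form sign_formV sign_form1.
under [X in _ - X * _]eq_bigr do rewrite mul1r.
under [X in _ - _ * X]eq_bigr do rewrite mul1r.
rewrite -![\sum_(i < n) -1 * _]mulr_sumr.
have -> : \sum_(a < n) 1 * f (x a) = \sum_(a < n) f (x a).
  by apply: eq_bigr => a _; rewrite mul1r.
rewrite sample_gapE; nra.
Qed.

Lemma rkhs_ball0 : rkhs_unit_ball k (fun=> 0).
Proof.
split=> [|n z c]; first exact: measurable_cst.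
rewrite big1 ?expr0n; last by move=> a _; rewrite mulr0.
by case: kpd => _; apply.
Qed.

(** The maximizer is the normalized witness function [sum_l (k(., x_l) - k(., y_l))], which
    Cauchy-Schwarz places in the ball. Measurable sections of [k] make it measurable, as membership
    in the ball demands. *)
Lemma sample_gap_attained n x y :
  (forall v, measurable_fun setT (k^~ v)) ->
  exists2 f, rkhs_unit_ball k f &
    \sum_(l < n) f (x l) - \sum_(l < n) f (y l) = Num.sqrt (sample_gap n x y).
Proof.
move=> mk; set S := sample_gap n x y.
have S0 : 0 <= S by apply: le_trans (sample_gap_ge n x y _ rkhs_ball0); exact: sqr_ge0.
(* A zero gap cannot be normalized; the zero function attains it. *)
have [S00|Sneq0] := eqVneq S 0.
  by exists (fun=> 0); [exact: rkhs_ball0|rewrite S00 sqrtr0 !big1// subr0].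
have {S0 Sneq0}S0 : 0 < S by rewrite lt_neqAle eq_sym Sneq0.
have sS0 : 0 < Num.sqrt S by rewrite sqrtr_gt0.
have SE := sqr_sqrtr (ltW S0).
pose u v := \sum_(l < n) (k v (x l) - k v (y l)).
exists (fun v => (Num.sqrt S)^-1 * u v).
  split.
    apply: measurable_funM; first exact: measurable_cst.
    apply: measurable_sum => l; exact: measurable_funB.
  move=> m z c.
  pose e := glue (fun=> 1 : R) (fun=> -1 : R) : 'I_(n + n) -> R.
  pose w := glue (fun l : 'I_n => x l) (fun l : 'I_n => y l).
  have eE : kernel_form k e w e w = S.
    rewrite kernel_form_gluel !kernel_form_gluer sign_form1 sign_formV.
    rewrite (kernel_formC k kpd _ (fun l : 'I_n => y l)) sign_form /S sample_gapE; ring.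
  have cE : \sum_(a < m) c a * ((Num.sqrt S)^-1 * u (z a)) =
      (Num.sqrt S)^-1 * kernel_form k c z e w.
    rewrite kernel_form_gluer /kernel_form -big_split mulr_sumr; apply: eq_bigr => a _.
    rewrite mulrCA; congr (_ * _) => /=; rewrite /u mulr_sumr -big_split.
    by apply: eq_bigr => b _ /=; ring.
  rewrite cE exprMn exprVn SE mulrC ler_pdivrMr// -eE.
  by apply: pd_cauchy_schwarz => //; rewrite eE.
have -> : \sum_(l < n) (Num.sqrt S)^-1 * u (x l) - \sum_(l < n) (Num.sqrt S)^-1 * u (y l)
    = (Num.sqrt S)^-1 * S.
  rewrite -!mulr_sumr -mulrBr; congr (_ * _).
  rewrite /S /sample_gap /u.
  have -> : \sum_(l < n) \sum_(m < n) (k (x l) (x m) + k (y l) (y m) - 2 * k (x l) (y m)) =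
     \sum_(l < n) \sum_(m < n) k (x l) (x m) + \sum_(l < n) \sum_(m < n) k (y l) (y m)
      - 2 * \sum_(l < n) \sum_(m < n) k (x l) (y m) by rewrite -sample_gapE.
  under eq_bigr do rewrite sumrB.
  under [X in _ - X = _]eq_bigr do rewrite sumrB.
  rewrite !sumrB.
  have -> : \sum_(l < n) \sum_(m < n) k (y l) (x m) =
      \sum_(l < n) \sum_(m < n) k (x l) (y m).
    rewrite exchange_big; apply: eq_bigr => l _; apply: eq_bigr => m _.
    exact: (proj1 kpd).
  ring.
by rewrite -{2}SE expr2 mulKf// gt_eqF.
Qed.

Lemma hat_dE {M : nat} (xs : 'I_M -> nat -> T) n i j :
  hat_d k xs n i j = n%:R^-1 * Num.sqrt (sample_gap n (xs i) (xs j)).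
Proof.
by rewrite /hat_d sqrtrM ?invr_ge0 ?sqr_ge0// -exprVn sqrtr_sqr ger0_norm ?invr_ge0.
Qed.

Lemma emp_mean_le_hat_d {M : nat} (xs : 'I_M -> nat -> T) n i j f :
  rkhs_unit_ball k f ->
  emp_mean n (xs i) f - emp_mean n (xs j) f <= hat_d k xs n i j.
Proof.
move=> fk; rewrite hat_dE /emp_mean -mulrBr ler_wpM2l ?invr_ge0//.
apply: le_trans (ler_norm _) _; rewrite -sqrtr_sqr ler_sqrt.
  exact: sample_gap_ge.
by apply: le_trans (sample_gap_ge _ _ _ _ fk); exact: sqr_ge0.
Qed.

Lemma hat_d_attained {M : nat} (xs : 'I_M -> nat -> T) n i j :
  (forall v, measurable_fun setT (k^~ v)) ->
  exists2 f, rkhs_unit_ball k f &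
    emp_mean n (xs i) f - emp_mean n (xs j) f = hat_d k xs n i j.
Proof.
move=> mk; have [f fk fE] := sample_gap_attained n (xs i) (xs j) mk.
by exists f => //; rewrite hat_dE /emp_mean -mulrBr fE.
Qed.

End RkhsBall.

(** * Monotonicity of the lower integral *)

Section LowerIntegral.
Local Open Scope ereal_scope.
Context {d : measure_display} {T : measurableType d} {R : realType}.
Variable mu : {measure set T -> \bar R}.

(* Without measurability: the integrand of the theorem depends on the arbitrary
   tie-breaking of SLINK, and the integral is then a lower integral. *)
Lemma ge0_le_lower_integral (f g : T -> \bar R) :
  (forall x, 0 <= f x) -> (forall x, f x <= g x) ->
  \int[mu]_x f x <= \int[mu]_x g x.
Proof.
move=> f0 fg; have g0 x : 0 <= g x by exact: le_trans (fg x).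
rewrite !ge0_integralTE//; apply: le_ereal_sup => _ [h /= hf <-].
by exists h => // x; exact: le_trans (hf x) (fg x).
Qed.

End LowerIntegral.

(** * Bounded measurable functions and their expectations *)

Section BoundedMeasurable.
Context {R : realType}.

(** This class is closed under the operations used below and integrable for every probability, so
    integrability need not be tracked separately. *)
Definition bounded_mfun {d : measure_display} {T : measurableType d} (f : T -> R) : Prop :=
  measurable_fun setT f /\ exists b : R, forall x, `|f x| <= b.

Context {d : measure_display} {T : measurableType d}.
Implicit Types (f g : T -> R).

Lemma bounded_mfun_cst (c : R) : bounded_mfun (fun _ : T => c).
Proof. by split; [exact: measurable_cst|exists `|c|]. Qed.

Lemma bounded_mfunD f g : bounded_mfun f -> bounded_mfun g ->
  bounded_mfun (fun x => f x + g x).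
Proof.
move=> [mf [b bf]] [mg [c cg]]; split; first exact: measurable_funD.
by exists (b + c) => x; apply: le_trans (ler_normD _ _) _; exact: lerD.
Qed.

Lemma bounded_mfunM f g : bounded_mfun f -> bounded_mfun g ->
  bounded_mfun (fun x => f x * g x).
Proof.
move=> [mf [b bf]] [mg [c cg]]; split; first exact: measurable_funM.
by exists (b * c) => x; rewrite normrM; exact: ler_pM.
Qed.

Lemma bounded_mfunZ c f : bounded_mfun f -> bounded_mfun (fun x => c * f x).
Proof. by move=> bf; apply: bounded_mfunM => //; exact: bounded_mfun_cst. Qed.

Lemma bounded_mfunB f g : bounded_mfun f -> bounded_mfun g ->
  bounded_mfun (fun x => f x - g x).
Proof.
move=> bf bg; have := bounded_mfunD _ _ bf (bounded_mfunZ (-1) _ bg).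
by congr bounded_mfun; apply/funext => x; rewrite mulN1r.
Qed.

Lemma bounded_mfun_sum (n : nat) (F : 'I_n -> T -> R) :
  (forall i, bounded_mfun (F i)) -> bounded_mfun (fun x => \sum_(i < n) F i x).
Proof.
move=> bF; split; first by apply: measurable_sum => i; case: (bF i).
have [b bP] : {b : 'I_n -> R & forall i x, `|F i x| <= b i}.
  by apply: (choice (P := fun i b => forall x, `|F i x| <= b)) => i; case: (bF i).
by exists (\sum_(i < n) b i) => x; apply: le_trans (ler_norm_sum _ _ _) _; exact: ler_sum.
Qed.

Lemma bounded_mfun_comp {d' : measure_display} {T' : measurableType d'}
  (Y : T' -> T) f : measurable_fun setT Y -> bounded_mfun f ->
  bounded_mfun (fun w => f (Y w)).
Proof.
move=> mY [mf [b bf]]; split; last by exists b.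
exact: (measurableT_comp mf mY).
Qed.

Variable P : probability T R.

Lemma bounded_mfun_integrable f : bounded_mfun f -> P.-integrable setT (EFin \o f).
Proof.
move=> [mf [b bf]]; apply: measurable_bounded_integrable => //.
  by rewrite /= probability_setT ltry.
exists b; split; first exact: num_real.
by move=> x bx y _; apply: le_trans (bf y) (ltW bx).
Qed.

Definition expect f : R := Rintegral P setT f.

Lemma expect_cst c : expect (fun=> c) = c.
Proof. by rewrite /expect Rintegral_cst//= probability_setT mulr1. Qed.

Lemma expectD f g : bounded_mfun f -> bounded_mfun g ->
  expect (fun x => f x + g x) = expect f + expect g.
Proof. by move=> bf bg; apply: RintegralD => //; exact: bounded_mfun_integrable. Qed.

Lemma expectB f g : bounded_mfun f -> bounded_mfun g ->
  expect (fun x => f x - g x) = expect f - expect g.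
Proof. by move=> bf bg; apply: RintegralB => //; exact: bounded_mfun_integrable. Qed.

Lemma expectZ c f : bounded_mfun f -> expect (fun x => c * f x) = c * expect f.
Proof. by move=> bf; apply: RintegralZl => //; exact: bounded_mfun_integrable. Qed.

Lemma expect_sum (n : nat) (F : 'I_n -> T -> R) : (forall i, bounded_mfun (F i)) ->
  expect (fun x => \sum_(i < n) F i x) = \sum_(i < n) expect (F i).
Proof.
elim: n F => [|n IH] F bF.
  rewrite big_ord0 -[RHS](expect_cst 0); congr expect; apply/funext => x.
  by rewrite big_ord0.
rewrite big_ord_recl -(IH (fun i => F (lift ord0 i)))//.
rewrite -expectD//; last exact: bounded_mfun_sum.
by congr expect; apply/funext => x; rewrite big_ord_recl.
Qed.

Lemma expect_le f g : bounded_mfun f -> bounded_mfun g ->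
  (forall x, f x <= g x) -> expect f <= expect g.
Proof.
by move=> bf bg fg; apply: le_Rintegral => //; exact: bounded_mfun_integrable.
Qed.

Lemma expect_norm_le f b : bounded_mfun f -> (forall x, `|f x| <= b) -> `|expect f| <= b.
Proof.
move=> bf fb.
rewrite ler_norml -{1 2}[b]expect_cst -mulN1r -expectZ; last exact: bounded_mfun_cst.
rewrite !expect_le//; try exact: bounded_mfunZ (bounded_mfun_cst _); try exact: bounded_mfun_cst.
- by move=> x; have := fb x; rewrite ler_norml => /andP[].
- by move=> x; have := fb x; rewrite ler_norml mulN1r => /andP[].
Qed.

Lemma expectE f : bounded_mfun f -> (\int[P]_x (f x)%:E = (expect f)%:E)%E.
Proof.
move=> bf; rewrite /expect /Rintegral fineK//.
by apply: integrable_fin_num => //; exact: bounded_mfun_integrable.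
Qed.

End BoundedMeasurable.

(** * Change of variables, and Fubini under independence *)

Section Law.
Context {R : realType} {dO : measure_display} {Om : measurableType dO}.
Variable P : probability Om R.

Lemma expect_law {d : measure_display} {T : measurableType d} (p : probability T R)
    (Y : Om -> T) (f : T -> R) : measurable_fun setT Y ->
  (forall A, measurable A -> P (Y @^-1` A) = p A) -> bounded_mfun f ->
  expect P (fun w => f (Y w)) = expect p f.
Proof.
move=> mY lawY bf; apply: EFin_inj.
rewrite -!expectE//; last exact: bounded_mfun_comp.
have mf : measurable_fun setT (EFin \o f) by apply/measurable_EFinP; case: bf.
transitivity (\int[pushforward P Y]_x (f x)%:E)%E; last first.
  by apply: eq_measure_integral => A mA _; exact: lawY.
rewrite integral_pushforward//.
exact: (bounded_mfun_integrable P (fun w => f (Y w))) (bounded_mfun_comp _ _ mY bf).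
Qed.

Context {d1 d2 : measure_display} {T1 : measurableType d1} {T2 : measurableType d2}.
Variables (p : probability T1 R) (U : Om -> T1) (V : Om -> T2).
Hypothesis mU : measurable_fun setT U.
Hypothesis mV : measurable_fun setT V.
Hypothesis lawU : forall A, measurable A -> P (U @^-1` A) = p A.
Hypothesis indepUV : forall A B, measurable A -> measurable B ->
  (P (U @^-1` A `&` V @^-1` B) = P (U @^-1` A) * P (V @^-1` B))%E.

(** By independence the joint law of [U] and [V] is the product of [p] and the law of [V]; Fubini
    integrates the first coordinate first and finds zero. *)
Lemma expect_indep0 (phi : T1 * T2 -> R) : bounded_mfun phi ->
  (forall z, expect p (fun x => phi (x, z)) = 0) ->
  expect P (fun w => phi (U w, V w)) = 0.
Proof.
move=> bphi phi0.
pose q : probability T2 R := distribution P (mfun_Sub (mem_set mV)).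
have mUV : measurable_fun setT (fun w => (U w, V w)) by exact: measurable_fun_pair.
have mphi : measurable_fun setT (EFin \o phi) by apply/measurable_EFinP; case: bphi.
apply: EFin_inj; rewrite -expectE; last exact: (bounded_mfun_comp (fun w => (U w, V w))).
transitivity (\int[pushforward P (fun w => (U w, V w))]_x (phi x)%:E)%E.
  rewrite integral_pushforward//.
  exact: (bounded_mfun_integrable P _ (bounded_mfun_comp _ _ mUV bphi)).
(* A product measure is determined by its values on rectangles, where independence applies. *)
transitivity (\int[(p \x q)%E]_x (phi x)%:E)%E.
  apply: eq_measure_integral => A mA _; apply/esym.
  apply: product_measure_unique => // B C mB mC.
  by rewrite /= /pushforward -lawU// -indepUV.
have iphi : (p \x q)%E.-integrable setT (EFin \o phi).
  apply: measurable_bounded_integrable => //.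
  - by rewrite /= -setXTT product_measure1E//= !probability_setT mule1 ltry.
  - by case: bphi.
  - case: bphi => _ [b bP]; exists b; split; first exact: num_real.
    by move=> x bx y _; apply: le_trans (bP y) (ltW bx).
rewrite -(integral21_prod_meas1 iphi) /fubini_G.
apply: integral0_eq => z _.
rewrite -[RHS]/(0%:E) -(phi0 z) -expectE//; apply: (bounded_mfun_comp (fun x => (x, z))) => //.
Qed.

End Law.

(** * Independence of one sample from all the others *)

Section Independence.
Context {R : realType} {dO : measure_display} {Om : measurableType dO}.
Context {dX : measure_display} {X : measurableType dX}.
Variables (P : probability Om R) (Y : nat -> Om -> X).
Hypothesis mY : forall l, measurable_fun setT (Y l).
Hypothesis indepY : mutually_independent P Y.

Let mpre l A : measurable A -> measurable (Y l @^-1` A).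
Proof. by move=> mA; rewrite -[X in measurable X]setTI; exact: mY. Qed.

(** A pi-system generating the sigma-algebra of the [Y l] with [l != a]. *)
Definition cylinders_avoiding (a : nat) : set (set Om) :=
  [set E | exists (s : seq nat) (A : nat -> set X), [/\ a \notin s, forall i, measurable (A i) &
    E = [set w | forall i, i \in s -> A i (Y i w)]]].

Let cylinderE (s : seq nat) (A : nat -> set X) :
  [set w | forall i, i \in s -> A i (Y i w)] =
  \big[setI/setT]_(i <- undup s) (Y i @^-1` A i).
Proof.
rewrite -bigcap_seq; apply/seteqP; split=> w /= Aw i /=.
  by rewrite mem_undup; exact: Aw.
by move=> si; apply: Aw; rewrite /= mem_undup.
Qed.

Let cylinder_measurable a : cylinders_avoiding a `<=` measurable.
Proof.
move=> _ [s [A [_ mA ->]]]; rewrite cylinderE.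
by apply: bigsetI_measurable => i _; exact: mpre.
Qed.

Let cylinder_setI a : setI_closed (cylinders_avoiding a).
Proof.
move=> _ _ [s [A [sa mA ->]]] [t [B [ta mB ->]]].
(* Outside its own index list each family is replaced by [setT], so that a single family describes
   the intersection. *)
exists (s ++ t), (fun i => (if i \in s then A i else setT) `&`
  (if i \in t then B i else setT)); split.
- by rewrite mem_cat negb_or sa.
- by move=> i; apply: measurableI; case: ifP.
- apply/seteqP; split=> w /= => [[Aw Bw] i _|ABw].
    by split; case: ifP => //; [exact: Aw|exact: Bw].
  by split=> i si; have := ABw i; rewrite mem_cat si ?orbT => /(_ isT)[].
Qed.

Let cylinder_indep a A E : measurable A -> cylinders_avoiding a E ->
  P (E `&` Y a @^-1` A) = (P (Y a @^-1` A) * P E)%E.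
Proof.
move=> mA [s [B [sa mB ->]]]; rewrite cylinderE.
(* [B'] carries [A] at index [a]; as [a] is not in [s], one family serves both [s] and
   [a :: undup s]. *)
pose B' i := if i == a then A else B i.
have mB' i : measurable (B' i) by rewrite /B'; case: eqP.
have BE : \big[setI/setT]_(i <- undup s) (Y i @^-1` B i) =
    \big[setI/setT]_(i <- undup s) (Y i @^-1` B' i).
  rewrite !big_seq; apply: eq_bigr => i; rewrite mem_undup => si.
  by rewrite /B'; case: eqP => // ia; move: sa; rewrite -ia si.
have us : uniq (a :: undup s) by rewrite /= mem_undup sa undup_uniq.
rewrite BE; have := indepY (a :: undup s) B' us mB'.
rewrite !big_cons (_ : B' a = A); last by rewrite /B' eqxx.
by rewrite setIC (indepY _ _ (undup_uniq s) mB').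
Qed.

(** Uniqueness of measures: with [D] the event on [Y a], restricting [P] to [D] and scaling [P] by
    [P D] give finite measures that agree on the pi-system. *)
Lemma sigma_avoiding_indep a A E : measurable A ->
  <<s cylinders_avoiding a >> E ->
  P (E `&` Y a @^-1` A) = (P (Y a @^-1` A) * P E)%E.
Proof.
move=> mA GE; have mD := mpre a A mA.
have fin : P (Y a @^-1` A) \is a fin_num by exact: fin_num_measure.
have r0 : (0 <= fine (P (Y a @^-1` A)))%R by exact: fine_ge0.
have m2E B : mscale (NngNum r0) P B = (P (Y a @^-1` A) * P B)%E.
  by rewrite /mscale /= fineK.
rewrite -m2E -[LHS]/(mrestr P mD E).
have HE : [set Z | cylinders_avoiding a Z /\ Z `<=` setT] = cylinders_avoiding a.
  by apply/seteqP; split=> [Z []//|Z].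
apply: (g_sigma_algebra_measure_unique_trace (cylinders_avoiding a) setT) => //.
- by move=> Z [/cylinder_measurable].
- by rewrite HE; exact: cylinder_setI.
- by rewrite /= m2E /mrestr setTI probability_setT mule1.
- by move=> Z [cZ _]; rewrite /= m2E; exact: cylinder_indep.
- by rewrite /= /mrestr setTI -ge0_fin_numE.
- by rewrite HE.
Qed.

Let msig a b : b != a ->
  measurable_fun (setT : set (g_sigma_algebraType (cylinders_avoiding a))) (Y b : _ -> X).
Proof.
move=> ba _ B mB; rewrite setTI; apply: sub_sigma_algebra.
exists [:: b], (fun=> B); split=> //; first by rewrite inE eq_sym.
apply/seteqP; split=> w /= => [Bw i|]; first by rewrite inE => /eqP ->.
by apply; rewrite inE.
Qed.

Variable p : probability X R.
Hypothesis lawY : forall l (A : set X), measurable A -> P (Y l @^-1` A) = p A.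

(** The indices [b], [c], [e] may coincide; it is enough that each differs from [a]. *)
Lemma expect_indep_sample a b c e (phi : X * (X * (X * X)) -> R) :
  b != a -> c != a -> e != a -> bounded_mfun phi ->
  (forall z, expect p (fun x => phi (x, z)) = 0) ->
  expect P (fun w => phi (Y a w, (Y b w, (Y c w, Y e w)))) = 0.
Proof.
move=> ba ca ea bphi phi0.
apply: (expect_indep0 P p (Y a) (fun w => (Y b w, (Y c w, Y e w)))) => //.
- by do 2 (apply: measurable_fun_pair => //).
- exact: lawY.
move=> A B mA mB; rewrite setIC; apply: sigma_avoiding_indep => //.
have mV : measurable_fun (setT : set (g_sigma_algebraType (cylinders_avoiding a)))
    (fun w => (Y b w, (Y c w, Y e w))).
  apply: (@measurable_fun_pair _ _ _ (g_sigma_algebraType (cylinders_avoiding a))).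
    exact: msig.
  apply: (@measurable_fun_pair _ _ _ (g_sigma_algebraType (cylinders_avoiding a))).
    exact: msig.
  exact: msig.
have := mV measurableT B mB; rewrite setTI; exact.
Qed.

End Independence.

Lemma sum_ord_const {R : realType} (n : nat) (c : R) : \sum_(l < n) c = n%:R * c.
Proof. by rewrite sumr_const card_ord mulr_natl. Qed.

Lemma sum_ord_delta {R : realType} (n : nat) (i : 'I_n) : \sum_(j < n) (i == j)%:R = 1 :> R.
Proof.
by rewrite (bigD1 i)//= eqxx big1 ?addr0// => j; rewrite eq_sym => /negbTE ->.
Qed.

(** * Mean embeddings and the degenerate V-statistic *)

Section MeanEmbedding.
Context {R : realType} {dX : measure_display} {X : measurableType dX}.
Variables (p : probability X R) (h : X -> X -> R).
Hypothesis bh : bounded_mfun (fun z : X * X => h z.1 z.2).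

(** For positive-definite [h], the value at [x] of the RKHS mean embedding of [p], whose squared
    norm is [mean_energy]. *)
Definition mean_embedding (x : X) : R := expect p (h x).

Definition mean_energy : R := expect p mean_embedding.

Lemma bounded_mfun_section x : bounded_mfun (h x).
Proof.
apply: (bounded_mfun_comp (fun y => (x, y)) _ _ bh).
by apply: measurable_fun_pair => //; exact: measurable_cst.
Qed.

Lemma mean_embedding_le b : (forall x y, `|h x y| <= b) ->
  forall x, `|mean_embedding x| <= b.
Proof. by move=> hb x; apply: expect_norm_le => //; exact: bounded_mfun_section. Qed.

(** Measurability of the partial integral is part of Fubini's theorem for [p \x p]. *)
Lemma bounded_mfun_mean_embedding : bounded_mfun mean_embedding.
Proof.
split; last by case: bh => _ [b hb]; exists b; apply: mean_embedding_le => x y; exact: (hb (x, y)).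
have ih : (p \x p)%E.-integrable setT (EFin \o (fun z : X * X => h z.1 z.2)).
  apply: measurable_bounded_integrable => //.
  - by rewrite /= -setXTT product_measure1E//= !probability_setT mule1 ltry.
  - by case: bh.
  - case: bh => _ [b bP]; exists b; split; first exact: num_real.
    by move=> x bx y _; apply: le_trans (bP y) (ltW bx).
apply/measurable_EFinP; have := measurable_fubini_F ih.
congr (measurable_fun _ _); apply/funext => x.
by rewrite /fubini_F /= expectE//; exact: bounded_mfun_section.
Qed.

(* The squared RKHS distance between the mean embeddings of the empirical
   measure of x_0, ..., x_(n-1) and of p. *)
Definition embedding_gap n (x : nat -> X) : R :=
  n%:R^-1 ^+ 2 * \sum_(l < n) \sum_(m < n) h (x l) (x m)
  - 2 * (n%:R^-1 * \sum_(l < n) mean_embedding (x l)) + mean_energy.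

(** The inner product of [h(x, .)] and [h(y, .)] after the mean embedding is subtracted from
    both. *)
Definition centered x y : R := h x y - mean_embedding x - mean_embedding y + mean_energy.

Lemma embedding_gap_centered n x : (0 < n)%N -> embedding_gap n x =
  n%:R^-1 ^+ 2 * \sum_(l < n) \sum_(m < n) centered (x l) (x m).
Proof.
move=> n0; have nn0 : n%:R != 0 :> R by rewrite pnatr_eq0 -lt0n.
have -> : \sum_(l < n) \sum_(m < n) centered (x l) (x m) =
    \sum_(l < n) \sum_(m < n) h (x l) (x m)
    - 2 * (n%:R * \sum_(l < n) mean_embedding (x l)) + n%:R ^+ 2 * mean_energy.
  rewrite /centered.
  transitivity (\sum_(l < n) (\sum_(m < n) h (x l) (x m) - n%:R * mean_embedding (x l)
     - \sum_(m < n) mean_embedding (x m) + n%:R * mean_energy)).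
    apply: eq_bigr => l _; rewrite big_split !sumrB /=.
    by rewrite !sum_ord_const.
  rewrite big_split !sumrB /= -mulr_sumr !sum_ord_const; ring.
by rewrite /embedding_gap; field.
Qed.

Lemma bounded_mfun_centered : bounded_mfun (fun z : X * X => centered z.1 z.2).
Proof.
apply: bounded_mfunD; last exact: bounded_mfun_cst.
have bm := bounded_mfun_mean_embedding.
apply: bounded_mfunB; last exact: (bounded_mfun_comp _ _ measurable_snd bm).
by apply: bounded_mfunB => //; exact: (bounded_mfun_comp _ _ measurable_fst bm).
Qed.

Lemma centered_le b : (forall x y, `|h x y| <= b) -> forall x y, `|centered x y| <= 4 * b.
Proof.
move=> hb x y; have hx := hb x y; have mx := mean_embedding_le b hb x.
have my := mean_embedding_le b hb y.
have Bb : `|mean_energy| <= b.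
  by apply: expect_norm_le; [exact: bounded_mfun_mean_embedding|exact: mean_embedding_le].
move: hx mx my Bb; rewrite /centered !ler_norml => /andP[? ?] /andP[? ?] /andP[? ?] /andP[? ?].
by apply/andP; split; lra.
Qed.

Hypothesis hC : forall x y, h x y = h y x.

(** The four terms integrate to the mean embedding at [z], minus the energy, minus the mean
    embedding at [z], plus the energy. *)
Lemma centered_degenerate z : expect p (centered^~ z) = 0.
Proof.
have bh1 : bounded_mfun (h^~ z).
  have -> : h^~ z = h z by apply/funext => x; exact: hC.
  exact: bounded_mfun_section.
have bm := bounded_mfun_mean_embedding.
rewrite /centered expectD; last exact: bounded_mfun_cst; last first.
  by apply: bounded_mfunB; [exact: bounded_mfunB|exact: bounded_mfun_cst].
rewrite expectB; [|exact: bounded_mfunB|exact: bounded_mfun_cst].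
rewrite expectB// !expect_cst.
have -> : expect p (h^~ z) = mean_embedding z.
  by congr expect; apply/funext => x; exact: hC.
by rewrite -/mean_energy; ring.
Qed.

Lemma centeredC x y : centered x y = centered y x.
Proof. by rewrite /centered hC; ring. Qed.

Context {dO : measure_display} {Om : measurableType dO}.
Variables (P : probability Om R) (Y : nat -> Om -> X).
Hypothesis mY : forall l, measurable_fun setT (Y l).
Hypothesis indepY : mutually_independent P Y.
Hypothesis lawY : forall l (A : set X), measurable A -> P (Y l @^-1` A) = p A.

Lemma bounded_mfun_pair (g : X -> X -> R) a b :
  bounded_mfun (fun z : X * X => g z.1 z.2) -> bounded_mfun (fun w => g (Y a w) (Y b w)).
Proof.
move=> bg; apply: (bounded_mfun_comp (fun w => (Y a w, Y b w)) _ _ bg).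
exact: measurable_fun_pair.
Qed.

(** The index [a] occurs once: integrating over [Y a] first, with the others frozen, gives zero by
    degeneracy. *)
Lemma expect_centered_isolated a b c e : b != a -> c != a -> e != a ->
  expect P (fun w => centered (Y a w) (Y b w) * centered (Y c w) (Y e w)) = 0.
Proof.
move=> ba ca ea.
pose phi (z : X * (X * (X * X))) := centered z.1 z.2.1 * centered z.2.2.1 z.2.2.2.
apply: (expect_indep_sample P Y mY indepY p lawY a b c e phi) => //.
  apply: bounded_mfunM.
    apply: (bounded_mfun_comp (fun z : X * (X * (X * X)) => (z.1, z.2.1)) _ _
      bounded_mfun_centered).
    apply: measurable_fun_pair => //; exact: (measurableT_comp measurable_fst).
  apply: (bounded_mfun_comp (fun z : X * (X * (X * X)) => z.2.2) _ _
    bounded_mfun_centered).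
  exact: (measurableT_comp measurable_snd).
move=> [z1 [z2 z3]]; rewrite /phi /=.
transitivity (expect p (fun x => centered z2 z3 * centered x z1)).
  by congr expect; apply/funext => x; rewrite mulrC.
rewrite expectZ ?centered_degenerate ?mulr0//.
apply: (bounded_mfun_comp (fun x => (x, z1)) _ _ bounded_mfun_centered).
by apply: measurable_fun_pair => //; exact: measurable_cst.
Qed.

Lemma expect_kernel_pair a b : a != b -> expect P (fun w => h (Y a w) (Y b w)) = mean_energy.
Proof.
move=> ab; have bm := bounded_mfun_mean_embedding.
(* Subtracting the mean embedding of the second variable centers [h] in the first; the last two
   coordinates are padding. *)
pose phi (z : X * (X * (X * X))) := h z.1 z.2.1 - mean_embedding z.2.1.
have bphi : bounded_mfun phi.
  have m1 : measurable_fun setT (fun z : X * (X * (X * X)) => z.2.1).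
    exact: (measurableT_comp measurable_fst).
  apply: bounded_mfunB; last exact: (bounded_mfun_comp _ _ m1 bm).
  apply: (bounded_mfun_comp (fun z : X * (X * (X * X)) => (z.1, z.2.1)) _ _ bh).
  exact: measurable_fun_pair.
have bmY : bounded_mfun (fun w => mean_embedding (Y b w)) by exact: bounded_mfun_comp.
have : expect P (fun w => h (Y a w) (Y b w) - mean_embedding (Y b w)) = 0.
  apply: (expect_indep_sample P Y mY indepY p lawY a b b b phi) => //; rewrite 1?eq_sym//.
  move=> [z1 z2]; rewrite /phi /= expectB ?expect_cst.
  - apply/eqP; rewrite subr_eq0; apply/eqP; congr expect.
    by apply/funext => x; exact: hC.
  - have -> : h^~ z1 = h z1 by apply/funext => x; exact: hC.
    exact: bounded_mfun_section.
  - exact: bounded_mfun_cst.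
rewrite expectB//; last exact: (bounded_mfun_pair h).
by move/eqP; rewrite subr_eq0 => /eqP ->; apply: (expect_law P p (Y b)) => // A; exact: lawY.
Qed.

(** Expanding the square gives sums over four indices, where a term with an isolated index vanishes.
    In the others the indices pair off: at most [3 n^2] terms, each at most [(4 b)^2], whence
    [48 = 3 * 16]. *)
Lemma expect_embedding_gap_sqr b n : (forall x y, `|h x y| <= b) -> (0 < n)%N ->
  expect P (fun w => embedding_gap n (Y^~ w) ^+ 2) <= 48 * b ^+ 2 * n%:R^-1 ^+ 2.
Proof.
move=> hb n0; have cb := centered_le b hb.
have nn0 : n%:R != 0 :> R by rewrite pnatr_eq0 -lt0n.
pose F l m l' m' w := centered (Y l w) (Y m w) * centered (Y l' w) (Y m' w).
have bF l m l' m' : bounded_mfun (F l m l' m').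
  by apply: bounded_mfunM; apply: (bounded_mfun_pair centered); exact: bounded_mfun_centered.
have -> : (fun w => embedding_gap n (Y^~ w) ^+ 2) = (fun w => n%:R^-1 ^+ 4 *
    \sum_(l < n) \sum_(m < n) \sum_(l' < n) \sum_(m' < n) F l m l' m' w).
  apply/funext => w; rewrite embedding_gap_centered// exprMn -exprM; congr (_ * _).
  rewrite expr2 mulr_suml; apply: eq_bigr => l _; rewrite mulr_suml; apply: eq_bigr => m _.
  by rewrite mulr_sumr; apply: eq_bigr => l' _; rewrite mulr_sumr.
have bF1 l m l' : bounded_mfun (fun w => \sum_(m' < n) F l m l' m' w).
  exact: bounded_mfun_sum.
have bF2 l m : bounded_mfun (fun w => \sum_(l' < n) \sum_(m' < n) F l m l' m' w).
  by apply: bounded_mfun_sum => l'.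
have bF3 l : bounded_mfun (fun w => \sum_(m < n) \sum_(l' < n) \sum_(m' < n) F l m l' m' w).
  by apply: bounded_mfun_sum => m.
rewrite expectZ; last by apply: bounded_mfun_sum => l.
rewrite expect_sum//.
(* The number of ways in which the four indices pair off, so at least [1] whenever they do. *)
pose pat (l m l' m' : 'I_n) : R :=
  (l == m)%:R * (l' == m')%:R + (l == l')%:R * (m == m')%:R + (l == m')%:R * (m == l')%:R.
have EF (l m l' m' : 'I_n) : expect P (F l m l' m') <= 16 * b ^+ 2 * pat l m l' m'.
  have Fb : expect P (F l m l' m') <= 16 * b ^+ 2.
    apply: le_trans (ler_norm _) _; apply: expect_norm_le => // w.
    rewrite /F normrM (_ : 16 * b ^+ 2 = (4 * b) * (4 * b)); last by ring.
    exact: ler_pM.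
  have b0 : 0 <= 16 * b ^+ 2 by rewrite mulr_ge0// sqr_ge0.
  have [pat1|pat0] := boolP [|| (l == m) && (l' == m'), (l == l') && (m == m')
      | (l == m') && (m == l')].
    apply: le_trans Fb _; rewrite ler_peMr//.
    rewrite /pat; have g0 (c : bool) : 0 <= c%:R :> R by case: c.
    have gM (c c' : bool) : 0 <= c%:R * c'%:R :> R by rewrite mulr_ge0.
    case/or3P: pat1 => /andP[-> ->]; rewrite mul1r ?mulr1n.
    - by rewrite -addrA lerDl addr_ge0.
    - by rewrite addrAC lerDr addr_ge0.
    - by rewrite lerDr addr_ge0.
  rewrite (_ : expect P (F l m l' m') = 0).
    by rewrite mulr_ge0// /pat !addr_ge0// mulr_ge0.
  (* These symmetries bring any of the four indices to the first position. *)
  have FC1 : F l m l' m' = F m l l' m' by apply/funext => w; rewrite /F (centeredC (Y l w)).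
  have FC2 : F l m l' m' = F l' m' l m by apply/funext => w; rewrite /F mulrC.
  have FC3 : F l m l' m' = F m' l' l m.
    by apply/funext => w; rewrite /F mulrC (centeredC (Y l' w)).
  have neqE (i j : 'I_n) : (i != j) = (nat_of_ord i != j) by rewrite -(inj_eq val_inj).
  have [/and3P[]|] := boolP [&& m != l, l' != l & m' != l].
    by rewrite !neqE => ? ? ?; apply: expect_centered_isolated.
  have [/and3P[]|] := boolP [&& l != m, l' != m & m' != m].
    by rewrite !neqE FC1 => ? ? ? _; apply: expect_centered_isolated.
  have [/and3P[]|] := boolP [&& m' != l', l != l' & m != l'].
    by rewrite !neqE FC2 => ? ? ? _ _; apply: expect_centered_isolated.
  have [/and3P[]|] := boolP [&& l' != m', l != m' & m != m'].
    by rewrite !neqE FC3 => ? ? ? _ _ _; apply: expect_centered_isolated.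
  (* Four indices none of which is isolated must pair off, which [pat0] excludes. *)
  by move: pat0; rewrite -!(inj_eq val_inj) /=; lia.
have pat_sum (l m : 'I_n) : \sum_(l' < n) \sum_(m' < n) pat l m l' m' = (l == m)%:R * n%:R + 2.
  rewrite /pat; under eq_bigr do rewrite !big_split /= -!mulr_sumr
    -mulr_suml !sum_ord_delta mul1r !mulr1.
  rewrite !big_split /= !sum_ord_delta sum_ord_const; ring.
have : \sum_(l < n) expect P (fun w => \sum_(m < n) \sum_(l' < n) \sum_(m' < n) F l m l' m' w)
    <= 16 * b ^+ 2 * (3 * n%:R ^+ 2).
  apply: (@le_trans _ _ (\sum_(l < n) \sum_(m < n) 16 * b ^+ 2 * ((l == m)%:R * n%:R + 2))).
    apply: ler_sum => l _; rewrite expect_sum//; apply: ler_sum => m _.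
    rewrite expect_sum// -pat_sum mulr_sumr; apply: ler_sum => l' _.
    by rewrite expect_sum// mulr_sumr; apply: ler_sum => m' _.
  rewrite le_eqVlt; apply/orP; left; apply/eqP.
  under eq_bigr do rewrite -mulr_sumr big_split /= -mulr_suml sum_ord_delta mul1r sum_ord_const.
  by rewrite sum_ord_const; ring.
move=> S; have n4 : 0 <= n%:R^-1 ^+ 4 :> R by rewrite exprn_ge0// invr_ge0.
apply: le_trans (ler_wpM2l n4 S) _.
by rewrite le_eqVlt; apply/orP; left; apply/eqP; field.
Qed.

(** Replace [p] by an auxiliary sample [Y] of size [N]. The form with weights [1/n] on [x] and
    [-1/N] on that sample is nonnegative, and its expectation exceeds the gap by at most [2 b / N],
    the contribution of the diagonal. Then [N] grows. *)
Lemma embedding_gap_ge0 n x : pd_kernel h -> (0 < n)%N -> 0 <= embedding_gap n x.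
Proof.
move=> hpd n0; have [mh [b hb']] := bh.
have hb u v : `|h u v| <= b by exact: (hb' (u, v)).
have nn0 : n%:R != 0 :> R by rewrite pnatr_eq0 -lt0n.
have bm := bounded_mfun_mean_embedding.
have b0 : 0 <= b by apply: le_trans (hb (x 0) (x 0)).
have key N : (0 < N)%N -> 0 <= embedding_gap n x + 2 * b * N%:R^-1.
  move=> N0; have NN0 : N%:R != 0 :> R by rewrite pnatr_eq0 -lt0n.
  pose c (_ : 'I_n) : R := n%:R^-1; pose e (_ : 'I_N) : R := - N%:R^-1.
  pose S w := kernel_form h c (fun l => x l) e (fun l => Y l w).
  pose D w := kernel_form h e (fun l => Y l w) e (fun l => Y l w).
  have bS1 (a : 'I_n) (m : 'I_N) : bounded_mfun (fun w => c a * e m * h (x a) (Y m w)).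
    by apply: bounded_mfunZ; apply: bounded_mfun_comp => //; exact: bounded_mfun_section.
  have bS2 (a : 'I_n) : bounded_mfun (fun w => \sum_(m < N) c a * e m * h (x a) (Y m w)).
    exact: bounded_mfun_sum.
  have bS : bounded_mfun S by exact: bounded_mfun_sum.
  have bD1 (a m : 'I_N) : bounded_mfun (fun w => e a * e m * h (Y a w) (Y m w)).
    by apply: bounded_mfunZ; exact: (bounded_mfun_pair h).
  have bD2 (a : 'I_N) : bounded_mfun (fun w => \sum_(m < N) e a * e m * h (Y a w) (Y m w)).
    exact: bounded_mfun_sum.
  have bD : bounded_mfun D by exact: bounded_mfun_sum.
  pose A := kernel_form h c (fun l => x l) c (fun l => x l).
  have : expect P (fun=> 0) <= expect P (fun w => A + 2 * S w + D w).
    apply: expect_le; first exact: bounded_mfun_cst.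
      apply: bounded_mfunD => //; apply: bounded_mfunD; first exact: bounded_mfun_cst.
      exact: bounded_mfunZ.
    by move=> w; exact: pd_form_add_ge0.
  rewrite expect_cst expectD//; last first.
    by apply: bounded_mfunD; [exact: bounded_mfun_cst|exact: bounded_mfunZ].
  rewrite expectD; [|exact: bounded_mfun_cst|exact: bounded_mfunZ].
  rewrite expect_cst expectZ//.
  have AE : A = n%:R^-1 ^+ 2 * \sum_(l < n) \sum_(m < n) h (x l) (x m).
    rewrite mulr_sumr; apply: eq_bigr => l _.
    by rewrite mulr_sumr; apply: eq_bigr => m _; rewrite expr2.
  have SE : expect P S = - (n%:R^-1 * \sum_(l < n) mean_embedding (x l)).
    rewrite /S /kernel_form expect_sum// mulr_sumr -sumrN; apply: eq_bigr => l _.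
    rewrite expect_sum//.
    transitivity (\sum_(m < N) - (n%:R^-1 * N%:R^-1 * mean_embedding (x l))).
      apply: eq_bigr => m _; rewrite expectZ; last first.
        by apply: bounded_mfun_comp => //; exact: bounded_mfun_section.
      rewrite (expect_law P p (Y m) (h (x l)))//; last exact: bounded_mfun_section.
        by rewrite -/(mean_embedding (x l)) /c /e; ring.
      by move=> B; exact: lawY.
    by rewrite sum_ord_const; field; rewrite nn0 NN0.
  have DE : expect P D <= mean_energy + 2 * b * N%:R^-1.
    rewrite /D /kernel_form expect_sum//.
    (* Off-diagonal terms average exactly to [mean_energy]; on the diagonal both quantities lie
       between [-b] and [b], so they differ by at most [2 * b]. *)
    apply: (@le_trans _ _ (\sum_(l < N) \sum_(m < N) N%:R^-1 ^+ 2 *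
        (mean_energy + 2 * b * (l == m)%:R))).
      apply: ler_sum => l _; rewrite expect_sum//; apply: ler_sum => m _.
      rewrite expectZ; last exact: (bounded_mfun_pair h).
      rewrite /e mulrNN -expr2 ler_wpM2l ?sqr_ge0//.
      have [->|lm] := eqVneq l m; last first.
        by rewrite expect_kernel_pair ?mulr0 ?addr0// (inj_eq val_inj).
      have /ler_normlP[_ E1] : `|expect P (fun w => h (Y m w) (Y m w))| <= b.
        by apply: expect_norm_le => //; exact: (bounded_mfun_pair h).
      have /ler_normlP[E2 _] : `|mean_energy| <= b.
        by apply: expect_norm_le => //; exact: mean_embedding_le.
      by rewrite mulr1; lra.
    rewrite le_eqVlt; apply/orP; left; apply/eqP.
    under eq_bigr do rewrite -mulr_sumr big_split /= -mulr_sumr sum_ord_delta sum_ord_const.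
    by rewrite sum_ord_const; field.
  rewrite /embedding_gap -AE SE; lra.
apply/ler_addgt0Pr => eps eps0.
(* The [+ 1] forces [N > 0] even when [b = 0]. *)
have [N NP] : exists N : nat, (2 * b + 1) / eps < N%:R.
  by exists (Num.truncn ((2 * b + 1) / eps)).+1; exact: truncnS_gt.
have N0 : (0 < N)%N.
  rewrite -(ltr_nat R); apply: lt_trans NP; rewrite divr_gt0//; lra.
apply: le_trans (key N N0) _; rewrite lerD2l.
rewrite ler_pdivrMr ?ltr0n// -ler_pdivrMl//.
apply: le_trans (ltW NP); rewrite mulrC ler_pM2r ?invr_gt0//; lra.
Qed.

End MeanEmbedding.

(** * Deviation of [hat_d] and of the SLINK spacing from their population values *)

Section Deviation.
Context {R : realType} {dX : measure_display} {X : measurableType dX}.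
Variables (k : X -> X -> R) (G : R).
Hypothesis kpd : pd_kernel k.
Hypothesis mk : measurable_fun setT (fun z : X * X => k z.1 z.2).
Hypothesis kG : forall x y, 0 <= k x y <= G.

Lemma kernel_norm_le x y : `|k x y| <= G.
Proof. by have /andP[k0 kG'] := kG x y; rewrite ger0_norm. Qed.

Lemma bounded_mfun_kernel : bounded_mfun (fun z : X * X => k z.1 z.2).
Proof. by split=> //; exists G => z; exact: kernel_norm_le. Qed.

(** At a single point the ball condition reads [f(x)^2 <= k(x, x)]. *)
Lemma rkhs_ball_le f : rkhs_unit_ball k f -> forall x, `|f x| <= Num.sqrt G.
Proof.
move=> [_ /(_ 1%N) fk] x; have := fk (fun=> x) (fun=> 1).
rewrite !big_ord1 !mul1r => fx; have /andP[k0 kG'] := kG x x.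
rewrite -sqrtr_sqr ler_sqrt; last exact: le_trans kG'.
exact: le_trans kG'.
Qed.

Lemma bounded_mfun_rkhs_ball f : rkhs_unit_ball k f -> bounded_mfun f.
Proof. by move=> fk; split; [case: fk|exists (Num.sqrt G); exact: rkhs_ball_le]. Qed.

(** The gap is linear in the kernel, and for the rank-one kernel of [f] it is the squared error of
    the empirical mean. *)
Lemma embedding_gap_subtensor (p : probability X R) f n x : bounded_mfun f ->
  embedding_gap p (fun u v => k u v - f u * f v) n x =
  embedding_gap p k n x - (emp_mean n x f - expect p f) ^+ 2.
Proof.
move=> bf; have bm := bounded_mfun_mean_embedding p k bounded_mfun_kernel.
have me u : mean_embedding p (fun u v => k u v - f u * f v) u =
    mean_embedding p k u - f u * expect p f.
  rewrite /mean_embedding expectB; last exact: bounded_mfunZ.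
    by rewrite expectZ.
  exact: bounded_mfun_section bounded_mfun_kernel u.
have en : mean_energy p (fun u v => k u v - f u * f v) = mean_energy p k - expect p f ^+ 2.
  rewrite /mean_energy.
  have -> : mean_embedding p (fun u v => k u v - f u * f v) =
      fun u => mean_embedding p k u - expect p f * f u.
    by apply/funext => u; rewrite me [expect p f * _]mulrC.
  by rewrite expectB//; [rewrite expectZ// expr2|exact: bounded_mfunZ].
rewrite /embedding_gap en /emp_mean.
under [\sum_(l < n) mean_embedding _ _ _]eq_bigr do rewrite me.
rewrite sumrB -mulr_suml.
have -> : \sum_(l < n) \sum_(m < n) (k (x l) (x m) - f (x l) * f (x m)) =
    \sum_(l < n) \sum_(m < n) k (x l) (x m) - (\sum_(l < n) f (x l)) ^+ 2.
  rewrite expr2 mulr_suml -sumrB; apply: eq_bigr => l _.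
  by rewrite mulr_sumr -sumrB.
by ring.
Qed.

Context {dO : measure_display} {Om : measurableType dO}.
Variables (P : probability Om R).

(** Nonnegativity of the gap for [k] minus the rank-one kernel of [f]. The sequence [x] is fixed;
    [Y] is the auxiliary sample of [embedding_gap_ge0]. *)
Lemma emp_mean_dev (p : probability X R) (Y : nat -> Om -> X) f n x :
  (forall l, measurable_fun setT (Y l)) -> mutually_independent P Y ->
  (forall l (A : set X), measurable A -> P (Y l @^-1` A) = p A) ->
  (0 < n)%N -> rkhs_unit_ball k f ->
  `|emp_mean n x f - expect p f| <= Num.sqrt (embedding_gap p k n x).
Proof.
move=> mY iY lY n0 fk; have bf := bounded_mfun_rkhs_ball f fk.
have := rkhs_ball_pd k kpd f fk; set h := fun u v => _ => hpd.
have bh : bounded_mfun (fun z : X * X => h z.1 z.2).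
  apply: bounded_mfunB; first exact: bounded_mfun_kernel.
  apply: bounded_mfunM; first exact: (bounded_mfun_comp _ _ measurable_fst bf).
  exact: (bounded_mfun_comp _ _ measurable_snd bf).
have := embedding_gap_ge0 p h bh (proj1 hpd) P Y mY iY lY n x hpd n0.
rewrite /h embedding_gap_subtensor// subr_ge0 => dev.
by rewrite -sqrtr_sqr ler_sqrt// (le_trans (sqr_ge0 _) dev).
Qed.

Variables (M : nat) (p : 'I_M -> probability X R) (Xs : 'I_M -> nat -> Om -> X).
Hypothesis mX : forall i l, measurable_fun setT (Xs i l).
Hypothesis iX : forall i, mutually_independent P (Xs i).
Hypothesis lX : forall i l (A : set X), measurable A -> P (Xs i l @^-1` A) = p i A.

(** Two suprema over the same ball are compared; the quantities maximized differ by at most [e],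
    uniformly in [f]. *)
Lemma hat_d_dev (xs : 'I_M -> nat -> X) n i j : (0 < n)%N ->
  `|hat_d k xs n i j - dist_pop k p i j| <=
  Num.sqrt (embedding_gap (p i) k n (xs i)) + Num.sqrt (embedding_gap (p j) k n (xs j)).
Proof.
move=> n0.
set e := (X in _ <= X).
have dev f a : rkhs_unit_ball k f -> `|emp_mean n (xs a) f - expect (p a) f| <=
    Num.sqrt (embedding_gap (p a) k n (xs a)).
  by move=> fk; apply: (emp_mean_dev (p a) (Xs a)) => //; exact: lX.
have gap f : rkhs_unit_ball k f ->
    `|(emp_mean n (xs i) f - emp_mean n (xs j) f) - (expect (p i) f - expect (p j) f)| <= e.
  move=> fk; have := dev f i fk; have := dev f j fk; rewrite /e !ler_norml.
  by move=> /andP[? ?] /andP[? ?]; apply/andP; split; lra.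
have msec v : measurable_fun setT (k^~ v).
  exact: (measurable_fun_pair1 v mk).
(* A real [sup] dominates the members only of a bounded set; here [hat_d] itself provides the
   bound. *)
have ubd : has_ubound [set Rintegral (p i) setT f - Rintegral (p j) setT f |
    f in rkhs_unit_ball k].
  exists (hat_d k xs n i j + e) => _ [f fk <-].
  rewrite -/(expect (p i) f) -/(expect (p j) f).
  have := emp_mean_le_hat_d k kpd xs n i j f fk.
  by have := gap f fk; rewrite ler_norml => /andP[]; lra.
rewrite ler_norml; apply/andP; split.
  suff : dist_pop k p i j <= hat_d k xs n i j + e by lra.
  apply: ge_sup.
    exists (Rintegral (p i) setT (fun=> 0) - Rintegral (p j) setT (fun=> 0)).
    by exists (fun=> 0) => //; exact: rkhs_ball0.
  move=> _ [f fk <-].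
  rewrite -/(expect (p i) f) -/(expect (p j) f).
  have := emp_mean_le_hat_d k kpd xs n i j f fk.
  by have := gap f fk; rewrite ler_norml => /andP[]; lra.
(* Conversely, the function attaining [hat_d] competes in the population supremum. *)
have [f fk fE] := hat_d_attained k kpd xs n i j msec.
have : expect (p i) f - expect (p j) f <= dist_pop k p i j.
  by apply: ub_le_sup => //; exists f.
by have := gap f fk; rewrite fE ler_norml => /andP[]; lra.
Qed.

Variables (K : nat) (lab : 'I_M -> 'I_K).
Hypothesis lab_surj : forall c, exists i, lab i = c.
Hypothesis K2 : (2 <= K)%N.
Hypothesis dIH : d_I (dist_pop k p) lab < d_H (dist_pop k p) lab.

(** The threshold [(e / 2) ^+ 2] makes the two square roots in [hat_d_dev] add up to at most [e]. *)
Lemma slink_gamma_dev (xs : 'I_M -> nat -> X) n Q e : (0 < n)%N -> 0 <= e ->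
  slink_output K (hat_d k xs n) Q ->
  (forall i, embedding_gap (p i) k n (xs i) <= (e / 2) ^+ 2) ->
  `|slink_gamma (hat_d k xs n) Q - d_H (dist_pop k p) lab| <= e.
Proof.
move=> n0 e0 sQ We; apply: slink_gamma_close => // i j.
have sW a : Num.sqrt (embedding_gap (p a) k n (xs a)) <= e / 2.
  rewrite -[leRHS]ger0_norm; last by rewrite divr_ge0.
  by rewrite -sqrtr_sqr ler_sqrt// sqr_ge0.
apply: le_trans (hat_d_dev xs n i j n0) _.
by have := sW i; have := sW j; lra.
Qed.

(** This bound holds for every sample, and so yields a sure ceiling on the spacing. *)
Lemma embedding_gap_le i n x : (0 < n)%N -> embedding_gap (p i) k n x <= 4 * G.
Proof.
move=> n0; rewrite embedding_gap_centered//.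
have nn0 : n%:R != 0 :> R by rewrite pnatr_eq0 -lt0n.
apply: (@le_trans _ _ (n%:R^-1 ^+ 2 * \sum_(l < n) \sum_(m < n) (4 * G))).
  rewrite ler_wpM2l ?sqr_ge0//; apply: ler_sum => l _; apply: ler_sum => m _.
  apply: le_trans (ler_norm _) _.
  exact: centered_le bounded_mfun_kernel _ kernel_norm_le _ _.
by rewrite !sum_ord_const le_eqVlt; apply/orP; left; apply/eqP; field.
Qed.

End Deviation.

(** * Pathwise bounds on the stopping time *)

Section StoppingTime.
Context {R : realType}.

(* Z dominates the indicator of the event that Gam n is not eps-close to D, so
   the sum of Z over n >= n0 counts the times at which the rule may misbehave. *)
Lemma stop_time_dev_fin (Gam Z : nat -> R) (D eps C gmax s : R) (n0 : nat) :
  0 < eps -> eps < D -> D <= gmax -> 1 <= C ->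
  (0 < n0)%N -> n0%:R <= C ^+ 2 / gmax ^+ 2 ->
  (forall n, 0 <= Z n) ->
  (forall n, (0 < n)%N -> Z n < 1 -> `|Gam n - D| <= eps) ->
  (forall n, (0 < n)%N -> Gam n <= gmax) ->
  (forall a b, (n0 <= a)%N -> \sum_(a <= m < b) Z m <= s) ->
  (`| stop_time Gam C * (C ^- 2)%:E - (D ^- 2)%:E | <=
  (((D - eps) ^- 2 - D ^- 2) + (D ^- 2 - (D + eps) ^- 2) + 3 * C ^- 2
   + (1 + D ^- 2) * s)%:E)%E.
Proof.
move=> eps0 epsD Dg C1 n00 n0C Z0 Zclose Gg Zs.
have C0 : 0 < C by exact: lt_le_trans C1.
have D0 : 0 < D by exact: lt_trans epsD.
have g0 : 0 < gmax by exact: lt_le_trans Dg.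
have De0 : 0 < D - eps by rewrite subr_gt0.
have s0 : 0 <= s by have := Zs n0 n0 (leqnn _); rewrite big_geq.
have Ci0 : 0 < C ^- 2 by rewrite invr_gt0 exprn_gt0.
have C1' : C ^- 2 <= 1 by rewrite invf_le1 ?exprn_gt0// exprn_ege1.
have Ds0 : 0 < D ^- 2 by rewrite invr_gt0 exprn_gt0.
have CC : C ^+ 2 * C ^- 2 = 1 by rewrite divff// gt_eqF// exprn_gt0.
have mono (x y : R) : 0 < x -> x <= y -> y ^- 2 <= x ^- 2.
  move=> x0 xy; rewrite lef_pV2 ?posrE ?exprn_gt0//; last exact: lt_le_trans xy.
  by rewrite lerXn2r// nnegrE ltW//; exact: lt_le_trans xy.
have m1 : D ^- 2 <= (D - eps) ^- 2 by apply: mono => //; lra.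
have m2 : (D + eps) ^- 2 <= D ^- 2 by apply: mono => //; lra.
(* From time [y] on, [C / sqrt n <= D - eps]. *)
pose y := C ^+ 2 * (D - eps) ^- 2.
have y0 : 0 <= y by rewrite mulr_ge0 ?invr_ge0 ?sqr_ge0.
(* One successor passes [y]; the other ensures [2 <= np], as the stopping rule requires. *)
pose np := (Num.truncn y).+2.
have npy : np%:R <= y + 2.
  by rewrite /np -addn2 natrD lerD2r; have /andP[] := truncn_itv y0.
have ynp n : (np <= n)%N -> y < n%:R.
  move=> npn; apply: lt_le_trans (truncnS_gt y) _; rewrite ler_nat.
  exact: leq_trans npn.
have n0np : (n0 <= np)%N.
  rewrite -(ler_nat R); apply: le_trans n0C _; apply: le_trans (ltW (ynp np (leqnn _))).
  by rewrite ler_wpM2l ?sqr_ge0//; apply: mono => //; lra.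
have stopP n : (np <= n)%N -> Z n < 1 -> C / Num.sqrt n%:R <= Gam n.
  move=> npn Zn; have n1 : (1 < n)%N by exact: leq_trans npn.
  have nR : 0 < n%:R :> R by rewrite ltr0n ltnW.
  have /ler_normlP[Gn _] := Zclose n (ltnW n1) Zn.
  apply: (@le_trans _ _ (D - eps)); last lra.
  rewrite ler_pdivrMr ?sqrtr_gt0// mulrC -ler_pdivrMr//.
  have q0 : 0 <= C / (D - eps) by rewrite divr_ge0// ltW.
  rewrite -(ger0_norm q0) -sqrtr_sqr ler_sqrt ?(ltW nR)//.
  by rewrite exprMn exprVn; exact: ltW (ynp n npn).
have [N NE] : exists N, N = stop_time Gam C by eexists.
rewrite -NE.
have N0 : (0 <= N)%E.
  by rewrite NE; apply: le_ereal_inf_tmp => _ [n _ <-]; rewrite lee_fin.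
(* The first time from [np] on with [Z < 1]. Without one, [truncn s + 1 > s] consecutive terms at
   least [1] would sum to more than [s]. *)
have [n npn [Zn nmin]] : exists2 n, (np <= n)%N & Z n < 1 /\
    forall m, (np <= m < n)%N -> 1 <= Z m.
  have ex : exists n, (np <= n)%N && (Z n < 1).
    apply: contrapT => nex.
    have Z1 m : (np <= m)%N -> 1 <= Z m.
      by move=> npm; rewrite leNgt; apply/negP => Zm; apply: nex; exists m; rewrite npm.
    have := Zs np (np + (Num.truncn s).+1)%N n0np.
    apply/negP; rewrite -ltNge; apply: lt_le_trans (truncnS_gt s) _.
    rewrite -[(Num.truncn s).+1 in leLHS](addKn np).
    apply: (@le_trans _ _ (\sum_(np <= m < np + (Num.truncn s).+1) (1 : R))).
      by rewrite sumr_const_nat.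
    by rewrite !big_seq ler_sum// => m; rewrite mem_index_iota => /andP[/Z1].
  case: (ex_minnP ex) => n /andP[npn Zn] nmin; exists n => //; split=> // m /andP[npm mn].
  rewrite leNgt; apply/negP => Zm.
  by have := nmin m; rewrite npm Zm leqNgt mn => /(_ isT).
have Nn : (N <= n%:R%:E)%E.
  rewrite NE; apply: ereal_inf_lbound; exists n => //; split; first exact: leq_trans npn.
  exact: stopP.
(* Each time from [np] to [n - 1] contributes at least [1] to a sum bounded by [s]. *)
have nle : n%:R <= np%:R + s.
  rewrite -lerBlDl -natrB//; apply: le_trans (Zs np n n0np).
  apply: (@le_trans _ _ (\sum_(np <= m < n) (1 : R))); first by rewrite sumr_const_nat.
  by rewrite !big_seq ler_sum// => m; rewrite mem_index_iota; exact: nmin.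
(* Stopping at [m] with [Z m < 1] forces [m >= C^2 / (D + eps)^2]. If [Z m >= 1], the ceiling [gmax]
   gives [n0 <= m], hence [1 <= s], and the left side is nonpositive. *)
have Nlow : (((D ^- 2 - ((D ^- 2 - (D + eps) ^- 2) + D ^- 2 * s)) * C ^+ 2)%:E <= N)%E.
  rewrite NE; apply: le_ereal_inf_tmp => _ [m [m2' stopm] <-]; rewrite lee_fin.
  have m0 : (0 < m)%N by exact: ltnW.
  have mR : 0 < m%:R :> R by rewrite ltr0n.
  have mlow (x : R) : 0 < x -> Gam m <= x -> C ^+ 2 / x ^+ 2 <= m%:R.
    move=> x0 Gx; have : C / Num.sqrt m%:R <= x by exact: le_trans stopm Gx.
    rewrite ler_pdivrMr ?sqrtr_gt0// => Cx.
    rewrite ler_pdivrMr ?exprn_gt0//.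
    have -> : m%:R * x ^+ 2 = (x * Num.sqrt m%:R) ^+ 2.
      by rewrite exprMn sqr_sqrtr ?(ltW mR)// mulrC.
    by rewrite lerXn2r// nnegrE ?mulr_ge0 ?sqrtr_ge0// ltW.
  have [Zm|Zm] := ltP (Z m) 1.
    have /ler_normlP[_ Gm] := Zclose m m0 Zm.
    have Gm' : Gam m <= D + eps by lra.
    apply: le_trans (mlow (D + eps) (addr_gt0 D0 eps0) Gm').
    rewrite [leRHS]mulrC ler_pM2r ?exprn_gt0//.
    by have := mulr_ge0 (ltW Ds0) s0; lra.
  have n0m : (n0 <= m)%N.
    by rewrite -(ler_nat R); apply: le_trans n0C _; exact: mlow g0 (Gg m m0).
  have s1 : 1 <= s.
    by apply: le_trans Zm _; have := Zs m m.+1 n0m; rewrite big_nat1.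
  apply: le_trans (ltW mR); rewrite mulr_le0_ge0 ?sqr_ge0//.
  have : D ^- 2 * 1 <= D ^- 2 * s by rewrite ler_pM2l.
  by rewrite mulr1; lra.
case: N {NE} N0 Nn Nlow => [r| |] //.
move=> r0 rn' rlow'.
have rn : r <= n%:R by rewrite -lee_fin.
have rlow : (D ^- 2 - ((D ^- 2 - (D + eps) ^- 2) + D ^- 2 * s)) * C ^+ 2 <= r.
  by rewrite -lee_fin.
rewrite -EFinM -EFinB abse_EFin lee_fin ler_norml.
have Dss : 0 <= D ^- 2 * s by rewrite mulr_ge0// ltW.
apply/andP; split.
  have : (D ^- 2 - ((D ^- 2 - (D + eps) ^- 2) + D ^- 2 * s)) * C ^+ 2 * C ^- 2 <= r * C ^- 2.
    by rewrite ler_pM2r.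
  rewrite -mulrA CC mulr1; lra.
have : r * C ^- 2 <= (y + 2 + s) * C ^- 2.
  by rewrite ler_pM2r//; apply: le_trans rn (le_trans nle _); rewrite lerD2r.
have : s * C ^- 2 <= s by rewrite ler_piMr.
have -> : (y + 2 + s) * C ^- 2 = (D - eps) ^- 2 * (C ^+ 2 * C ^- 2) + 2 * C ^- 2 + s * C ^- 2.
  by rewrite /y; ring.
rewrite CC; lra.
Qed.

(** The tail series takes the place of [s]; if it diverges, the right side is [+oo]. *)
Lemma stop_time_dev (Gam Z : nat -> R) (D eps C gmax : R) (n0 : nat) :
  0 < eps -> eps < D -> D <= gmax -> 1 <= C ->
  (0 < n0)%N -> n0%:R <= C ^+ 2 / gmax ^+ 2 ->
  (forall n, 0 <= Z n) ->
  (forall n, (0 < n)%N -> Z n < 1 -> `|Gam n - D| <= eps) ->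
  (forall n, (0 < n)%N -> Gam n <= gmax) ->
  (`| stop_time Gam C * (C ^- 2)%:E - (D ^- 2)%:E | <=
  (((D - eps) ^- 2 - D ^- 2) + (D ^- 2 - (D + eps) ^- 2) + 3 * C ^- 2)%:E
   + (1 + D ^- 2)%:E * \sum_(0 <= n <oo) (Z (n0 + n)%N)%:E)%E.
Proof.
move=> eps0 epsD Dg C1 n00 n0C Z0 Zclose Gg.
have D1 : 0 < 1 + D ^- 2.
  by rewrite ltr_pwDl// invr_ge0 exprn_ge0// ltW// (lt_trans eps0).
have part n : ((\sum_(0 <= m < n) Z (n0 + m)%N)%:E <=
    \sum_(0 <= n <oo) (Z (n0 + n)%N)%:E)%E.
  rewrite -sumEFin; apply: nneseries_lim_ge => m _ _; rewrite lee_fin; exact: Z0.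
case: (\sum_(0 <= n <oo) _)%E part => [s| |] part.
- rewrite -EFinM -EFinD; apply: (stop_time_dev_fin Gam Z D eps C gmax s n0) => // a b n0a.
  have [ba|ab] := leqP b a.
    rewrite big_geq//; have := part 0%N; rewrite big_geq//.
  have := part (b - n0)%N; rewrite lee_fin; apply: le_trans.
  have -> : \sum_(0 <= m < b - n0) Z (n0 + m)%N = \sum_(n0 <= m < b) Z m.
    rewrite [RHS](_ : _ = \sum_(0 + n0 <= m < b) Z m)// big_addn.
    by apply: eq_bigr => m _; rewrite addnC.
  rewrite (@big_cat_nat _ _ _ a n0 b)//=; last exact: ltnW.
  by rewrite lerDr sumr_ge0.
- by rewrite gt0_muley ?lte_fin// addey// leey.
- by have := part 0%N.
Qed.

End StoppingTime.

(** * Estimates for tails and differences of inverse squares *)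

Section Tails.
Context {R : realType}.

(** Telescoping with [1/x^2 <= 2/x - 2/(x + 1)] for [x >= 1]. *)
Lemma sum_inv_sqr_le (n0 q : nat) : (0 < n0)%N ->
  \sum_(0 <= m < q) (n0 + m)%N%:R^-1 ^+ 2 <= 2 / n0%:R :> R.
Proof.
move=> n00.
suff : \sum_(0 <= m < q) (n0 + m)%N%:R^-1 ^+ 2 <= 2 / n0%:R - 2 / (n0 + q)%N%:R :> R.
  by move=> /le_trans; apply; rewrite gerBl divr_ge0.
elim: q => [|q IH]; first by rewrite big_geq// addn0 subrr.
rewrite big_nat_recr//=; apply: le_trans (lerD IH (lexx _)) _.
have x1 : 1 <= (n0 + q)%N%:R :> R by rewrite ler1n addn_gt0 n00.
rewrite addnS -[(n0 + q).+1%:R]natr1; move: ((n0 + q)%N%:R : R) x1 => x x1.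
have x0 : x != 0 by rewrite gt_eqF//; lra.
have x10 : x + 1 != 0 by rewrite gt_eqF//; lra.
rewrite -subr_ge0.
have -> : 2 / n0%:R - 2 / (x + 1) - (2 / n0%:R - 2 / x + x^-1 ^+ 2) =
    (x - 1) / (x ^+ 2 * (x + 1)) by field; rewrite x0 x10 pnatr_eq0 -lt0n n00.
by rewrite divr_ge0 ?mulr_ge0 ?sqr_ge0//; lra.
Qed.

Lemma nneseries_inv_sqr_le (c : R) (n0 : nat) (u : nat -> R) : (0 < n0)%N ->
  (forall n, 0 <= u n) -> (forall n, u n <= c * (n0 + n)%N%:R^-1 ^+ 2) -> 0 <= c ->
  (\sum_(0 <= n <oo) (u n)%:E <= (c * (2 / n0%:R))%:E)%E.
Proof.
move=> n00 u0 uc c0; apply: lime_le.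
  by apply: is_cvg_nneseries => n _ _; rewrite lee_fin.
apply: nearW => q; rewrite sumEFin lee_fin.
apply: (@le_trans _ _ (\sum_(0 <= m < q) c * (n0 + m)%N%:R^-1 ^+ 2)).
  exact: ler_sum.
by rewrite -mulr_sumr ler_wpM2l// sum_inv_sqr_le.
Qed.

(** The difference is [4 D eps / ((D - eps)^2 (D + eps)^2)], where [D - eps >= D/2] and
    [D + eps >= D]. *)
Lemma inv_sqr_gap_le (D eps : R) : 0 < eps -> eps <= D / 2 ->
  (D - eps) ^- 2 - (D + eps) ^- 2 <= 16 * eps / D ^+ 3.
Proof.
move=> eps0 epsD; have D0 : 0 < D by lra.
have u0 : D - eps != 0 by rewrite gt_eqF//; lra.
have v0 : D + eps != 0 by rewrite gt_eqF//; lra.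
have D0' : D != 0 by rewrite gt_eqF.
have -> : (D - eps) ^- 2 - (D + eps) ^- 2 =
    4 * D * eps * ((D - eps) ^+ 2 * (D + eps) ^+ 2)^-1 by field; rewrite u0 v0.
have -> : 16 * eps / D ^+ 3 = 4 * D * eps * ((D / 2) ^+ 2 * D ^+ 2)^-1 by field.
rewrite ler_pM2l ?mulr_gt0//.
rewrite lef_pV2 ?posrE ?mulr_gt0 ?exprn_gt0//; try lra.
by rewrite ler_pM ?sqr_ge0// lerXn2r// ?nnegrE; lra.
Qed.

End Tails.

(** * Mean convergence of the normalized stopping time *)

Lemma mutually_independent_row {R : realType} {dO dX : measure_display}
    {Om : measurableType dO} {X : measurableType dX} (P : probability Om R)
    (M : nat) (Xs : 'I_M -> nat -> Om -> X) :
  mutually_independent P (fun il : 'I_M * nat => Xs il.1 il.2) ->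
  forall i, mutually_independent P (Xs i).
Proof.
move=> ind i s A us mA.
have := ind (map (pair i) s) (fun il => A il.2); rewrite !big_map /=; apply.
- by rewrite map_inj_uniq// => l m [].
- by move=> il.
Qed.

(** [sel n w] stands for any SLINK output at time [n], so ties are broken arbitrarily, possibly in a
    way not measurable in [w]. *)
Theorem theorem4 (R : realType)
  (dX : measure_display) (X : measurableType dX)
  (k : X -> X -> R) (G : R)
  (M K : nat) (lab : 'I_M -> 'I_K) (p : 'I_M -> probability X R)
  (dO : measure_display) (Om : measurableType dO) (P : probability Om R)
  (Xs : 'I_M -> nat -> Om -> X)
  (sel : nat -> Om -> {set {set 'I_M}}) :
  (2 <= M)%N -> (2 <= K)%N ->
  (forall c : 'I_K, exists i : 'I_M, lab i = c) ->
  pd_kernel k ->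
  measurable_fun setT (fun z : X * X => k z.1 z.2) ->
  (forall x y, 0 <= k x y <= G) ->
  (forall i l, measurable_fun setT (Xs i l)) ->
  (forall i l (A : set X), measurable A -> P (Xs i l @^-1` A) = p i A) ->
  mutually_independent P (fun il : 'I_M * nat => Xs il.1 il.2) ->
  (forall n w, slink_output K (hat_d k (fun i l => Xs i l w) n) (sel n w)) ->
  d_I (dist_pop k p) lab < d_H (dist_pop k p) lab ->
  (fun C : R =>
     (\int[P]_w
        `| stop_time
             (fun n => slink_gamma (hat_d k (fun i l => Xs i l w) n) (sel n w)) C
           * ((C ^- 2)%:E)
           - (((d_H (dist_pop k p) lab) ^- 2)%:E) |)%E)
    x @[x --> +oo] --> (0 : \bar R).
Proof.
move=> M2 K2 lab_surj kpd mk kG mX lX ind sQ dIH.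
have iX := mutually_independent_row P M Xs ind.
set D := d_H (dist_pop k p) lab in dIH *.
(* [d_I] is a maximum with default [0], hence nonnegative. *)
have D0 : 0 < D.
  apply: le_lt_trans dIH; rewrite /d_I; elim/big_ind: _ => // [x y x0 y0|c _].
    by rewrite le_max x0.
  rewrite /d_I_cluster; elim/big_rec: _ => // A x _ x0.
  by rewrite le_max x0 orbT.
have G0 : 0 <= G by have /andP[k0] := kG point point; exact: le_trans k0.
have bk := bounded_mfun_kernel k G mk kG.
pose W i n w := embedding_gap (p i) k n (Xs i ^~ w).
have bW i n : bounded_mfun (W i n).
  apply: bounded_mfunD; last exact: bounded_mfun_cst.
  apply: bounded_mfunB; apply: bounded_mfunZ.
    apply: bounded_mfun_sum => l; apply: bounded_mfun_sum => m.
    exact: (bounded_mfun_pair (Xs i) (mX i) k).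
  apply: bounded_mfunZ; apply: bounded_mfun_sum => l.
  exact: (bounded_mfun_comp _ _ (mX i l) (bounded_mfun_mean_embedding (p i) k bk)).
have EW i n : (0 < n)%N -> expect P (fun w => W i n w ^+ 2) <= 48 * G ^+ 2 * n%:R^-1 ^+ 2.
  move=> n0; apply: (expect_embedding_gap_sqr (p i) k bk (proj1 kpd) P (Xs i)) => //.
  - exact: lX.
  - exact: kernel_norm_le kG.
pose Gam n w := slink_gamma (hat_d k (fun i l => Xs i l w) n) (sel n w).
(* For [e = 4 sqrt G] the threshold [(e / 2)^2] equals [4 G], which bounds every gap; the spacing
   then surely stays below [D + e]. *)
pose gmax := D + 4 * Num.sqrt G.
have Dg : D <= gmax by rewrite lerDl mulr_ge0// sqrtr_ge0.
have g0 : 0 < gmax by exact: lt_le_trans Dg.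
have Gg w n : (0 < n)%N -> Gam n w <= gmax.
  move=> n0; have e0 : 0 <= 4 * Num.sqrt G by rewrite mulr_ge0// sqrtr_ge0.
  have := slink_gamma_dev k G kpd mk kG P M p Xs mX iX lX K lab lab_surj K2 dIH
    (fun i l => Xs i l w) n (sel n w) _ n0 e0 (sQ n w).
  have We i : embedding_gap (p i) k n (Xs i ^~ w) <= (4 * Num.sqrt G / 2) ^+ 2.
    apply: le_trans (embedding_gap_le k G mk kG M p i n _ n0) _.
    rewrite !exprMn sqr_sqrtr//; lra.
  by move=> /(_ We) /ler_normlP[_]; rewrite -/D -/(Gam n w) /gmax; lra.
(* The factor is chosen so that a single [W i n w > (eps / 2)^2] already gives [Z >= 1]. *)
pose Z eps n w := 16 * eps ^- 4 * \sum_(i < M) W i n w ^+ 2.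
have bZ eps n : bounded_mfun (Z eps n).
  by apply: bounded_mfunZ; apply: bounded_mfun_sum => i; exact: bounded_mfunM.
have Z0 eps n w : 0 < eps -> 0 <= Z eps n w.
  move=> eps0; rewrite mulr_ge0 ?mulr_ge0 ?invr_ge0 ?exprn_ge0 ?(ltW eps0)//.
  by apply: sumr_ge0 => i _; exact: sqr_ge0.
have Zclose eps n w : 0 < eps -> (0 < n)%N -> Z eps n w < 1 -> `|Gam n w - D| <= eps.
  move=> eps0 n0 Z1.
  apply: (slink_gamma_dev k G kpd mk kG P M p Xs mX iX lX K lab lab_surj K2 dIH
    (fun i l => Xs i l w) n (sel n w) _ n0 (ltW eps0) (sQ n w)) => i.
  rewrite -/(W i n w) leNgt; apply/negP => We; move: Z1; apply/negP; rewrite -leNgt.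
  have e2 : 0 <= (eps / 2) ^+ 2 by exact: sqr_ge0.
  have W2 : (eps / 2) ^+ 2 ^+ 2 <= W i n w ^+ 2.
    by rewrite lerXn2r ?nnegrE ?(ltW We)// (le_trans e2)// ltW.
  have e4 : 0 < 16 * eps ^- 4 by rewrite mulr_gt0// invr_gt0 exprn_gt0.
  apply: (@le_trans _ _ (16 * eps ^- 4 * (eps / 2) ^+ 2 ^+ 2)).
    by rewrite le_eqVlt; apply/orP; left; apply/eqP; field; rewrite gt_eqF.
  rewrite ler_pM2l//; apply: le_trans W2 _; rewrite (bigD1 i)//= lerDl.
  by apply: sumr_ge0 => j _; exact: sqr_ge0.
pose cst eps : R := 16 * eps ^- 4 * (M%:R * (48 * G ^+ 2)).
have cst0 eps : 0 < eps -> 0 <= cst eps.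
  move=> eps0; rewrite !mulr_ge0 ?invr_ge0 ?exprn_ge0 ?(ltW eps0)//.
have EZ eps n : 0 < eps -> (0 < n)%N -> expect P (Z eps n) <= cst eps * n%:R^-1 ^+ 2.
  move=> eps0 n0; rewrite expectZ; last by apply: bounded_mfun_sum => i; exact: bounded_mfunM.
  rewrite expect_sum; last by move=> i; exact: bounded_mfunM.
  rewrite /cst -[leRHS]mulrA ler_pM2l; last by rewrite mulr_gt0// invr_gt0 exprn_gt0.
  apply: (@le_trans _ _ (\sum_(i < M) 48 * G ^+ 2 * n%:R^-1 ^+ 2)).
    by apply: ler_sum => i _; exact: EW.
  by rewrite sum_ord_const mulrA.
(* With [n0] the integer part of [C^2 / gmax^2], the last term is of order [C^-2] for fixed
   [eps]. *)
have bound eps C : 0 < eps -> eps < D -> 1 <= C -> (0 < Num.truncn (C ^+ 2 / gmax ^+ 2))%N ->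
    (\int[P]_w `| stop_time (fun n => Gam n w) C * (C ^- 2)%:E - (D ^- 2)%:E | <=
    (((D - eps) ^- 2 - (D + eps) ^- 2) + 3 * C ^- 2 + (1 + D ^- 2) *
      (cst eps * (2 / (Num.truncn (C ^+ 2 / gmax ^+ 2))%:R)))%:E)%E.
  move=> eps0 epsD C1; set n0 := Num.truncn _ => n00.
  have n0C : n0%:R <= C ^+ 2 / gmax ^+ 2.
    by rewrite truncn_le divr_ge0// sqr_ge0.
  pose a : R := ((D - eps) ^- 2 - (D + eps) ^- 2) + 3 * C ^- 2.
  have a0 : 0 <= a.
    rewrite addr_ge0//; last by rewrite mulr_ge0// invr_ge0 sqr_ge0.
    rewrite subr_ge0 lef_pV2 ?posrE ?exprn_gt0//; try lra.
    by rewrite lerXn2r// ?nnegrE; lra.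
  have D10 : 0 <= 1 + D ^- 2 by rewrite addr_ge0// invr_ge0 sqr_ge0.
  have mZ n : measurable_fun setT (fun w => (Z eps (n0 + n)%N w)%:E).
    by apply/measurable_EFinP; case: (bZ eps (n0 + n)%N).
  have Z0' n w : (0 <= (Z eps (n0 + n)%N w)%:E)%E by rewrite lee_fin Z0.
  (* The possibly nonmeasurable integrand is first replaced by a measurable majorant; only that
     majorant is integrated termwise. *)
  apply: (@le_trans _ _ (\int[P]_w (a%:E +
      (1 + D ^- 2)%:E * \sum_(0 <= n <oo) (Z eps (n0 + n)%N w)%:E))%E).
    apply: ge0_le_lower_integral => w; first exact: abse_ge0.
    have -> : a = ((D - eps) ^- 2 - D ^- 2) + (D ^- 2 - (D + eps) ^- 2) + 3 * C ^- 2.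
      by rewrite /a; ring.
    apply: (stop_time_dev (fun n => Gam n w) (fun n => Z eps n w) D eps C gmax n0) => //.
    - by move=> n; exact: Z0.
    - by move=> n; exact: Zclose.
    - by move=> n; exact: Gg.
  have mS : measurable_fun setT (fun w => \sum_(0 <= n <oo) (Z eps (n0 + n)%N w)%:E)%E.
    exact: ge0_emeasurable_sum.
  have S0 w : (0 <= \sum_(0 <= n <oo) (Z eps (n0 + n)%N w)%:E)%E by exact: nneseries_ge0.
  rewrite ge0_integralD//; last 2 first.
  - by move=> w _; rewrite mule_ge0// lee_fin.
  - by apply: measurable_funeM.
  rewrite integral_cst//= probability_setT mule1 ge0_integralZl//.
  rewrite integral_nneseries//.
  rewrite -/a [leRHS]EFinD EFinM; apply: leeD2l; apply: lee_wpmul2l; first by rewrite lee_fin.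
  under eq_eseriesr do rewrite expectE//.
  apply: nneseries_inv_sqr_le => // [n|n|].
  - by apply: Rintegral_ge0 => w _; exact: Z0.
  - by apply: EZ => //; rewrite addn_gt0 n00.
  - exact: cst0.
apply/fine_cvgP.
suff main eta : 0 < eta -> \forall C \near +oo,
    (\int[P]_w `| stop_time (fun n => Gam n w) C * (C ^- 2)%:E - (D ^- 2)%:E | <= eta%:E)%E.
  have I0 C : (0 <= \int[P]_w `| stop_time (fun n => Gam n w) C * (C ^- 2)%:E - (D ^- 2)%:E |)%E.
    by apply: integral_ge0 => w _; exact: abse_ge0.
  split.
    apply: filterS (main 1 ltr01) => C HC.
    by rewrite ge0_fin_numE ?I0//; apply: le_lt_trans HC _; rewrite ltry.
  apply/cvgrPdist_le => eta eta0; apply: filterS (main eta eta0) => C HC.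
  rewrite sub0r normrN /= ger0_norm ?fine_ge0 ?I0//.
  by rewrite -lee_fin fineK// ge0_fin_numE ?I0//; apply: le_lt_trans HC _; rewrite ltry.
move=> eta0.
(* The first bound meets the hypothesis of [inv_sqr_gap_le]; the second makes [16 eps / D^3] at most
   [eta / 3]. *)
pose eps := Num.min (D / 2) (eta * D ^+ 3 / 48).
have eps0 : 0 < eps by rewrite lt_min divr_gt0//= divr_gt0// mulr_gt0// exprn_gt0.
have epsD2 : eps <= D / 2 by rewrite ge_min lexx.
have epsD : eps < D by lra.
pose c2 := (1 + D ^- 2) * cst eps * 2.
have c20 : 0 <= c2 by rewrite mulr_ge0// mulr_ge0 ?cst0// addr_ge0// invr_ge0 sqr_ge0.
(* [c2 / n0 <= eta / 3] amounts to [n0 >= L]. *)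
pose L := 3 * c2 / eta.
have L0 : 0 <= L by rewrite /L divr_ge0 ?(ltW eta0)// mulr_ge0.
have gL : 0 <= gmax ^+ 2 * (L + 2) by rewrite mulr_ge0 ?sqr_ge0// addr_ge0.
have e9 : 0 < 9 / eta by rewrite divr_gt0.
(* The three summands ensure in turn [1 <= C], [3 / C^2 <= eta / 3] and [C^2 / gmax^2 >= L + 2]; the
   spare [2] absorbs the truncation in [n0]. *)
apply: filterS (nbhs_pinfty_ge (num_real (1 + 9 / eta + gmax ^+ 2 * (L + 2)))) => C HC.
have C1 : 1 <= C by lra.
have C0 : 0 < C by lra.
have CC : C <= C ^+ 2 by rewrite expr2 ler_peMr// ltW.
pose n0 := Num.truncn (C ^+ 2 / gmax ^+ 2).
have n0L : L + 1 < n0%:R.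
  have : L + 2 < n0.+1%:R.
    apply: le_lt_trans (truncnS_gt _); rewrite ler_pdivlMr ?exprn_gt0// mulrC; lra.
  by rewrite -natr1; lra.
have n0R : 0 < n0%:R :> R by lra.
have n00 : (0 < n0)%N by rewrite -(ltr0n R).
apply: le_trans (bound eps C eps0 epsD C1 n00) _; rewrite lee_fin -/n0.
have t1 : (D - eps) ^- 2 - (D + eps) ^- 2 <= eta / 3.
  apply: le_trans (inv_sqr_gap_le D eps eps0 epsD2) _.
  have D3 : 0 < D ^+ 3 by rewrite exprn_gt0.
  rewrite ler_pdivrMr//; have : eps <= eta * D ^+ 3 / 48 by rewrite ge_min lexx orbT.
  by lra.
have t2 : 3 * C ^- 2 <= eta / 3.
  have C20 : 0 < C ^+ 2 by rewrite exprn_gt0.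
  rewrite ler_pdivrMr// mulrC -ler_pdivrMr ?divr_gt0//.
  have -> : 3 / (eta / 3) = 9 / eta by field; rewrite gt_eqF.
  lra.
have t3 : (1 + D ^- 2) * (cst eps * (2 / n0%:R)) <= eta / 3.
  have -> : (1 + D ^- 2) * (cst eps * (2 / n0%:R)) = c2 / n0%:R by rewrite /c2; ring.
  rewrite ler_pdivrMr// mulrC -ler_pdivrMr ?divr_gt0//.
  have -> : c2 / (eta / 3) = L by rewrite /L; field; rewrite gt_eqF.
  lra.
lra.
Qed.
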